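(* Let $\rho_\psi$ be the irreducible representation over $\mathcal{K}$ of the Heisenberg group $H$ with central character $\psi$. Then its character/rationality field is $R(\rho_\psi)=\mathcal{K}$ and its Schur index is $m(\rho_\psi)=1$.
   Context: $F$ is a field of characteristic $\neq 2$ that is either finite of cardinality $q=p^f$ or non-archimedean local with residue field of cardinality $q=p^f$. $R_0$ is $\mathbb{Q}$ or $\mathbb{F}_\ell$ with $\ell\neq p$; $\mathcal{K}=R_0[\zeta_p]$ if $\mathrm{char}(F)>0$ and $\mathcal{K}=\bigcup_kR_0[\zeta_{p^k}]$ if $\mathrm{char}(F)=0$. $\psi:F\to\mathcal{K}^\times$ is a non-trivial smooth character. $(W,\langle\ ,\ \rangle)$ is a finite dimensional symplectic $F$-vector space and $H=W\times F$ is the Heisenberg group with law $(w,t)(w',t')=(w+w',t+t'+\frac12\langle w,w'\rangle)$, with centre $F$. By the Stone--von Neumann theorem there is, up to isomorphism, a unique irreducible smooth representation $\rho_\psi$ of $H$ over $\mathcal{K}$ with central character $\psi$; it is admissible and absolutely irreducible. For an admissible, finitely generated, absolutely irreducible smooth representation $V$ of a locally profinite group $G$ over an algebraic extension $R$ of $R_0$, the character/rationality field $R(V)$ is the subfield of $R$ generated by $R_0$ and the traces on $V$ of the elements of the Hecke algebra $C_c^\infty(G,R_0)$; it equals the fixed field of $\{\sigma\in\mathrm{Aut}(R):V^\sigma\simeq V\}$, where $V^\sigma$ is the twist of $V$ by $\sigma$. A subfield $R'$ of an algebraic closure $\bar R$ of $R$ is a field of realisation of $V$ if there is a smooth representation $V'$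 of $G$ over $R'$ with $V'\otimes_{R'}\bar R\simeq V\otimes_R\bar R$. The Schur index $m(V)$ is the infimum of the degrees $[R':R(V)]$ over the fields of realisation $R'$ of $V$. *)

(* Defs.v *)
From HB Require Import structures.
From mathcomp Require Import all_boot all_order all_algebra.
From mathcomp Require Import all_classical topology.

Set Implicit Arguments.
Unset Strict Implicit.
Unset Printing Implicit Defensive.

Import Order.TTheory GRing.Theory Num.Theory.

Local Open Scope classical_set_scope.
Local Open Scope ring_scope.

(* As for PreTopologicalZmodule in the library, the two joins below impose no
   compatibility between the topology and the operations.  It is not needed to
   state the definitions; it holds for the fields satisfying
   finite_or_local_field and for their Heisenberg groups. *)
#[short(type="preTopologicalFieldType")]
HB.structure Definition PreTopologicalField :=
  {F of GRing.Field F & Topological F}.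

#[short(type="preTopologicalGroupType")]
HB.structure Definition PreTopologicalGroup :=
  {G of Group G & Topological G}.

(* The value of a valuation at 0 is irrelevant. *)
Record normalized_valuation (F : fieldType) (v : F -> int) : Prop := {
  valuationM : forall x y, x != 0 -> y != 0 -> v (x * y) = v x + v y;
  valuationD : forall x y, x != 0 -> y != 0 -> x + y != 0 ->
    Num.min (v x) (v y) <= v (x + y);
  valuation_surj : exists2 x, x != 0 & v x = 1 }.

(* The fractional ideal of elements of valuation at least n. *)
Definition val_ideal (F : fieldType) (v : F -> int) (n : int) : set F :=
  [set x | x = 0 \/ n <= v x].

Definition nonarch_local_field (F : preTopologicalFieldType) (q : nat) : Prop :=
  exists v : F -> int,
    [/\ normalized_valuation v,
        forall (x : F) (A : set F),
          nbhs x A <-> exists n, [set y | val_ideal v n (y - x)] `<=` A,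
        forall u : nat -> F,
          (forall n, exists N, forall i j, (N <= i)%N -> (N <= j)%N ->
             val_ideal v n (u i - u j)) ->
          exists l : F, u @ \oo --> l
      & (* q representatives of the residue field *)
        exists r : 'I_q -> F, (forall i, val_ideal v 0 (r i)) /\
          forall x, val_ideal v 0 x -> exists! i, val_ideal v 1 (x - r i)].

Definition discrete_finite_field (F : preTopologicalFieldType) (q : nat) : Prop :=
  ([set: F] #= `I_q)%card /\ forall A : set F, open A.

Definition finite_or_local_field (F : preTopologicalFieldType) (q : nat) : Prop :=
  discrete_finite_field F q \/ nonarch_local_field F q.

(* None stands for the characteristic 0. *)
Definition prime_field (c : option nat) : fieldType :=
  if c is Some l then ('F_l : fieldType) else (rat : fieldType).

Definition allowed_characteristic (p : nat) (c : option nat) : Prop :=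
  if c is Some l then prime l /\ l <> p else True.

Definition generated_by (R0 K : fieldType) (iota0 : {rmorphism R0 -> K}) (z : K)
  : set K := [set (map_poly iota0 P).[z] | P in [set: {poly R0}]].

Definition cyclotomic_coefficients (F : fieldType) (p : nat) (R0 K : fieldType)
    (iota0 : {rmorphism R0 -> K}) : Prop :=
  ((exists c : nat, c \in [pchar F]) ->
     exists2 z : K, p.-primitive_root z & generated_by iota0 z = [set: K]) /\
  ([pchar F] =i pred0 ->
     (forall k, exists z : K, (p ^ k).-primitive_root z) /\
     (forall x : K, exists k, exists2 z : K,
        (p ^ k).-primitive_root z & generated_by iota0 z x)).

Definition locally_constant (X : topologicalType) (T : Type) (f : X -> T) : Prop :=
  forall a : T, open (f @^-1` [set a]).

(* psi never vanishes, since psi x * psi (- x) = 1. *)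
Definition smooth_character (F : preTopologicalFieldType) (K : fieldType)
    (psi : F -> K) : Prop :=
  [/\ psi 0 = 1, {morph psi : x y / x + y >-> x * y} & locally_constant psi].

Section Heisenberg.
Variables (F : preTopologicalFieldType) (W : vectType F).

(* The form is a parameter because the group law depends on it. *)
Definition heisenberg (form : {skew_symmetric W}) : Type := (W * F)%type.

Variable form : {skew_symmetric W}.
Local Notation H := (heisenberg form).
Implicit Types x y : H.

Definition heis_mul x y : H :=
  (x.1 + y.1, x.2 + y.2 + 2^-1 * form x.1 y.1).
Definition heis_one : H := (0, 0).
(* form x.1 x.1 = 0 in characteristic other than 2; with this term the group
   axioms need no hypothesis on F. *)
Definition heis_inv x : H := (- x.1, - x.2 + 2^-1 * form x.1 x.1).

Fact heis_mulA : associative heis_mul.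
Proof.
move=> [w s] [w' s'] [w'' s'']; rewrite /heis_mul /=; congr pair.
  by rewrite addrA.
rewrite linearDr linearDl !mulrDr !addrA.
rewrite [RHS]addrAC; congr (_ + _).
by rewrite [LHS]addrAC; congr (_ + _); rewrite [LHS]addrAC.
Qed.

Fact heis_mul1x : left_id heis_one heis_mul.
Proof. by case=> w s; rewrite /heis_mul /= linear0l mulr0 addr0 !add0r. Qed.

Fact heis_mulx1 : right_id heis_one heis_mul.
Proof. by case=> w s; rewrite /heis_mul /= linear0r mulr0 !addr0. Qed.

Fact heis_mulxV : right_inverse heis_one heis_inv heis_mul.
Proof.
case=> w s; rewrite /heis_mul /heis_one /=; congr pair; first by rewrite subrr.
by rewrite linearNr mulrN addrA addrK subrr.
Qed.

Fact heis_mulVx : left_inverse heis_one heis_inv heis_mul.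
Proof.
case=> w s; rewrite /heis_mul /heis_one /=; congr pair; first by rewrite addNr.
by rewrite linearNl mulrN addrAC addrK addNr.
Qed.

(* The finite-dimensional space W has the topology transported from F^n by
   coordinates in some basis (hence in every basis). *)
Definition heis_coord x : 'rV[F]_(\dim {:W}) * F :=
  (\row_i coord (vbasis {:W}) i x.1, x.2).

HB.instance Definition _ := Choice.on H.
HB.instance Definition _ :=
  isGroup.Build H heis_mulA
    heis_mul1x heis_mulx1 heis_mulVx heis_mulxV.
HB.instance Definition _ :=
  Topological.copy H (initial_topology heis_coord).

Definition heis_center (t : F) : H := (0, t).

End Heisenberg.

Record representation (G : groupType) (R : fieldType) (V : lmodType R) :=
  Representation {
    rep_act :> G -> {linear V -> V};
    rep_act1 : forall v, rep_act 1%g v = v;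
    rep_actM : forall g h v, rep_act (g * h)%g v = rep_act g (rep_act h v) }.

Arguments representation : clear implicits.

Definition smooth (G : preTopologicalGroupType) (R : fieldType) (V : lmodType R)
    (rho : representation G R V) : Prop :=
  forall v, open [set g | rho g v = v].

Definition irreducible (G : groupType) (R : fieldType) (V : lmodType R)
    (rho : representation G R V) : Prop :=
  (exists v : V, v != 0) /\
  forall U : {pred V}, GRing.submod_closed U ->
    (forall g v, v \in U -> rho g v \in U) ->
    (forall v, v \in U -> v = 0) \/ (forall v, v \in U).

Definition central_character (F : preTopologicalFieldType) (W : vectType F)
    (form : {skew_symmetric W}) (K : fieldType) (V : lmodType K)
    (rho : representation (heisenberg form) K V) (psi : F -> K) : Prop :=
  forall t v, rho (heis_center form t) v = psi t *: v.

Section RationalityField.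
Variables (G : preTopologicalGroupType) (R0 R : fieldType).
Variable iota0 : {rmorphism R0 -> R}.

Definition compact_open (A : set G) : Prop := compact A /\ open A.

(* Left Haar measures with values in R0; only the values on compact open sets
   matter. *)
Definition haar_measure (mu : set G -> R0) : Prop :=
  [/\ forall A B, compact_open A -> compact_open B -> A `&` B = set0 ->
        mu (A `|` B) = mu A + mu B,
      forall g A, compact_open A -> mu [set (g * x)%g | x in A] = mu A
    & exists2 A, compact_open A & mu A != 0].

(* The underlying space of the Hecke algebra C_c^oo(G, R0). *)
Definition hecke_function (f : G -> R0) : Prop :=
  locally_constant f /\ compact [set g | f g != 0].

Variables (V : lmodType R) (rho : representation G R V).

(* The integral of f(g) rho(g) v with respect to mu.  For rho smooth, the
   integrand takes finitely many values, its nonzero ones on compact open sets,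
   so the integral is the sum of the w * mu {integrand = w}. *)
Definition hecke_act (mu : set G -> R0) (f : G -> R0) (v : V) : V :=
  \sum_(w \in [set: V])
    iota0 (mu [set g | iota0 (f g) *: rho g v = w]) *: w.

(* Trace of an endomorphism of finite rank: e is a basis of a finite-dimensional
   subspace containing the image of T. *)
Definition is_trace (T : V -> V) (t : R) : Prop :=
  exists (n : nat) (e : 'I_n -> V) (A : 'M[R]_n),
    [/\ forall c : 'I_n -> R, \sum_i c i *: e i = 0 -> forall i, c i = 0,
        forall v, exists c : 'I_n -> R, T v = \sum_i c i *: e i,
        forall i, T (e i) = \sum_j A i j *: e j
      & t = \tr A].

(* All Haar measures are allowed: they are proportional over R0, so that the
   subfield generated does not depend on the choice of one of them. *)
Definition hecke_traces : set R :=
  [set t | exists mu f,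
    [/\ haar_measure mu, hecke_function f & is_trace (hecke_act mu f) t]].

Definition rationality_field : set R :=
  [set x | forall L : {pred R}, GRing.divring_closed L ->
    (forall a, iota0 a \in L) -> (forall t, hecke_traces t -> t \in L) ->
    x \in L].

End RationalityField.

(* b : V -> VL exhibits VL as the extension of scalars of V along j. *)
Definition is_scalar_extension (R L : fieldType) (j : {rmorphism R -> L})
    (V : lmodType R) (VL : lmodType L) (b : {linear V -> VL | j \; *:%R}) : Prop :=
  forall (M : lmodType L) (f : {linear V -> M | j \; *:%R}),
    exists g : {linear VL -> M}, (forall v, g (b v) = f v) /\
      forall g' : {linear VL -> M}, (forall v, g' (b v) = f v) -> g' =1 g.

Definition is_rep_extension (G : groupType) (R L : fieldType)
    (j : {rmorphism R -> L}) (V : lmodType R) (rho : representation G R V)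
    (VL : lmodType L) (rhoL : representation G L VL) : Prop :=
  exists b : {linear V -> VL | j \; *:%R},
    is_scalar_extension b /\ forall g v, rhoL g (b v) = b (rho g v).

Definition is_algebraic_closure (R : fieldType) (Rbar : closedFieldType)
    (iota : {rmorphism R -> Rbar}) : Prop :=
  forall x, algebraicOver iota x.

(* L is given as the image of a field R' by an embedding j; the representations
   over R' and over R become isomorphic over Rbar when they have a common
   extension of scalars rhobar. *)
Definition field_of_realisation (G : preTopologicalGroupType) (R : fieldType)
    (V : lmodType R) (rho : representation G R V) (Rbar : closedFieldType)
    (iota : {rmorphism R -> Rbar}) (L : set Rbar) : Prop :=
  exists (R' : fieldType) (j : {rmorphism R' -> Rbar}),
    range j = L /\
    exists (V' : lmodType R') (rho' : representation G R' V'),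
      smooth rho' /\
      exists (Vbar : lmodType Rbar) (rhobar : representation G Rbar Vbar),
        is_rep_extension j rho' rhobar /\ is_rep_extension iota rho rhobar.

(* [L : k] = d, for subfields k and L of E. *)
Definition extension_degree (E : fieldType) (k L : set E) (d : nat) : Prop :=
  k `<=` L /\
  exists e : 'I_d -> E,
    [/\ forall i, L (e i),
        forall c : 'I_d -> E, (forall i, k (c i)) ->
          \sum_i c i * e i = 0 -> forall i, c i = 0
      & forall x, L x -> exists2 c : 'I_d -> E,
          forall i, k (c i) & x = \sum_i c i * e i].

Section SchurIndex.
Variables (G : preTopologicalGroupType) (R0 R : fieldType).
Variables (iota0 : {rmorphism R0 -> R}) (V : lmodType R).
Variables (rho : representation G R V) (Rbar : closedFieldType).
Variable iota : {rmorphism R -> Rbar}.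

Definition realisation_degree (d : nat) : Prop :=
  exists2 L : set Rbar, field_of_realisation rho iota L
    & extension_degree (iota @` rationality_field iota0 rho) L d.

(* m is the infimum, in N with infinity, of the degrees of the fields of
   realisation; infinite degrees do not affect a finite infimum. *)
Definition is_schur_index (m : nat) : Prop :=
  realisation_degree m /\ forall d, realisation_degree d -> (m <= d)%N.

End SchurIndex.

(* Main.v *)
(* Among the compact open subgroups U of H contained in a fixed compact set, containing
   a fixed small lattice and having a nonzero fixed vector, a maximal one (of p-power
   index over the lattice) has an image in W equal to its own orthogonal under psi o <,>: a nontrivial step up would adjoin (w, t) with
   w orthogonal to U, where t corrects the eigenvalue, a p-power root of unity, of w
   on V^U.  Since V is spanned by the translates of a vector x0 of V^U, which are
   eigenvectors of U with character psi(<., w>), V^U is the line K x0.  Hence for z = (0, t)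
   the operator of the indicator function of zU has trace vol(U) psi(t), and vol(U) is a
   p-power up to normalisation, so it is nonzero in R0: the traces generate the values
   of psi, which contain roots of unity generating K over R0.  As rho is then defined
   over its rationality field, the Schur index is 1. *)

Require Import Defs.
From HB Require Import structures.
From mathcomp Require Import all_boot all_order all_algebra.
From mathcomp Require Import generic_quotient.
From mathcomp Require Import all_classical topology.
From mathcomp Require Import zify ring.

Set Implicit Arguments.
Unset Strict Implicit.
Unset Printing Implicit Defensive.

Import Order.TTheory GRing.Theory Num.Theory.

Local Open Scope classical_set_scope.
Local Open Scope ring_scope.

(** * Cosets and compact open sets *)

(** The field [K] need not be algebraically closed and [R0] may have positive characteristic, so
    each eigenvalue has to be found inside [K] and each index has to be invertible in [R0]. The
    eigenvalues that occur are powers of one value [psi x1], whose order [p ^ N] is such that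
    [p ^ N] carries every candidate [w] into the small lattice; an eigenvalue [psi (x1 *+ i)] is
    cancelled by the central element of coordinate [- (x1 *+ i)]. This dictates the compact set,
    which is chosen before [U]: it must contain the vectors orthogonal to the lattice under [psi],
    bounded because the form is nondegenerate, and all these central corrections. Orthogonality then
    splits the translates of [x0]: those by elements over the orthogonal of [U] stay on its line,
    the others have nontrivial characters and cannot contribute to a fixed vector. Finite and local
    fields are treated together through a chain of ideals with steps of p-power index. Residue
    characteristic 2 is allowed, so [2^-1] is absorbed in a constant [m] that bounds the form on
    lattices. *)

Section Tilings.
Variable G : groupType.
Implicit Types (A B C U : set G) (x y g : G).

Definition subgroup U :=
  [/\ U 1%g, forall x y, U x -> U y -> U (x * y)%g & forall x, U x -> U x^-1%g].

(** For a subgroup [B] of a group [A] this says that the index is [n]. Arbitrary sets are allowed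
    because compact open sets are measured by counting tiles; an arbitrary finite index type lets
    towers and disjoint unions use products and sums of types. *)
Definition tiled B A (n : nat) := exists (T : finType) (r : T -> G),
  [/\ #|T| = n, forall x, A x <-> exists i, B ((r i)^-1 * x)%g
    & forall i j x, B ((r i)^-1 * x)%g -> B ((r j)^-1 * x)%g -> i = j].

Lemma subgroup_divl U x y : subgroup U -> U x -> U (x^-1 * y)%g <-> U y.
Proof.
move=> [_ UM UV] Ux; split=> Uy; last exact/UM/Uy/UV.
by rewrite -(mulVKg x y); exact: UM.
Qed.

Lemma subgroup_trans U x y z : subgroup U ->
  U (x^-1 * y)%g -> U (y^-1 * z)%g -> U (x^-1 * z)%g.
Proof. by move=> [_ UM _] Uxy /(UM _ _ Uxy); rewrite -mulgA mulVKg. Qed.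

Lemma subgroup_sym U x y : subgroup U -> U (x^-1 * y)%g -> U (y^-1 * x)%g.
Proof. by move=> [_ _ UV] /UV; rewrite invgM invgK. Qed.

Lemma tiled_refl B : tiled B B 1.
Proof.
exists unit, (fun=> 1%g); split; first by rewrite card_unit.
  by move=> x; rewrite invg1 mul1g; split=> [|[]//]; exists tt.
by move=> [] [].
Qed.

Lemma tiled_trans B C A m n : tiled B C m -> tiled C A n -> tiled B A (n * m).
Proof.
move=> [T [r [<- rC rI]]] [T' [r' [<- rC' rI']]].
exists (T' * T)%type, (fun i => r' i.1 * r i.2)%g; split.
- by rewrite card_prod.
- move=> x; rewrite rC'; split=> [[i /rC[j Bij]]|[[i j] /= Bij]].
    by exists (i, j); rewrite /= invgM -mulgA.
  by exists i; apply/rC; exists j; rewrite mulgA -invgM.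
- move=> [i j] [i' j'] x /=; rewrite !invgM -!mulgA => Bij Bij'.
  have ii' : i = i' by apply: (rI' _ _ x); apply/rC; [exists j|exists j'].
  by subst i'; rewrite (rI _ _ _ Bij Bij').
Qed.

(** Each representative of a tile of [A] lies in a tile of [A'], and two of them in the same coset
    of [B] coincide. This bounds the exponents when a maximal subgroup is chosen. *)
Lemma tiled_le B A A' m n : subgroup B -> A `<=` A' ->
  tiled B A m -> tiled B A' n -> (m <= n)%N.
Proof.
move=> sB AA' [T [r [<- rC rI]]] [T' [r' [<- rC' rI']]].
have [B1 BM BV] := sB.
have Ar i : A (r i) by apply/rC; exists i; rewrite mulVg.
have /choice[f fP] : forall i, exists j, B ((r' j)^-1 * r i)%g.
  by move=> i; apply/rC'/AA'.
apply: (@leq_card _ _ f) => i j fij.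
apply: (rI _ _ (r j)); last by rewrite mulVg.
have := fP j; rewrite -fij -(subgroup_divl _ sB (fP i)).
by rewrite invgM invgK mulgA -(mulgA _ (r' (f i))) mulgV mulg1.
Qed.

Lemma tiled_uniq B A m n : subgroup B -> tiled B A m -> tiled B A n -> m = n.
Proof.
move=> sB Am An; apply/eqP.
by rewrite eqn_leq !(@tiled_le B A A).
Qed.

Lemma tiledU B A A' m n : tiled B A m -> tiled B A' n -> A `&` A' = set0 ->
  tiled B (A `|` A') (m + n).
Proof.
move=> [T [r [<- rC rI]]] [T' [r' [<- rC' rI']]] AA'.
have dis x : A x -> A' x -> False by rewrite -[False]/(set0 x) -AA'.
exists (T + T')%type, (fun i => match i with inl i => r i | inr i => r' i end).
split; first by rewrite card_sum.
  move=> x; split=> [[/rC|/rC'] [i Bi]|[[i|i] Bi]].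
  - by exists (inl i).
  - by exists (inr i).
  - by left; apply/rC; exists i.
  - by right; apply/rC'; exists i.
move=> [i|i] [j|j] x Bi Bj.
- by rewrite (rI _ _ _ Bi Bj).
- by case: (dis x); [apply/rC; exists i|apply/rC'; exists j].
- by case: (dis x); [apply/rC; exists j|apply/rC'; exists i].
- by rewrite (rI' _ _ _ Bi Bj).
Qed.

Lemma tiled_translate B A n g : tiled B A n ->
  tiled B [set (g * x)%g | x in A] n.
Proof.
move=> [T [r [<- rC rI]]]; exists T, (fun i => g * r i)%g; split=> //.
  move=> x; split=> [[y /rC[i Bi] <-]|[i]].
    by exists i; rewrite invgM -!mulgA mulKg.
  rewrite invgM -mulgA => Bi; exists (g^-1 * x)%g; last by rewrite mulVKg.
  by apply/rC; exists i.
by move=> i j x; rewrite !invgM -!mulgA; exact: rI.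
Qed.

Lemma tiled0 B : tiled B set0 0.
Proof.
by exists void, (of_void G); split=> [|x|[]]; rewrite ?card_void //; split=> // -[[]].
Qed.

(* From a covering by cosets, discard those meeting the previous ones. *)
Lemma covered_tiled B A (s : seq G) : subgroup B ->
  (forall x, A x <-> exists2 g, g \in s & B (g^-1 * x)%g) ->
  exists n, tiled B A n.
Proof.
move=> sB; have [B1 BM BV] := sB; elim: s A => [|g s IH] A AE.
  exists 0%N; rewrite (_ : A = set0); first exact: tiled0.
  by apply/seteqP; split=> // x /AE[].
pose A' := [set x | exists2 h, h \in s & B (h^-1 * x)%g].
have [n An] := IH A' (fun x => iff_refl _).
have [A'g|A'g] := pselect (A' g).
  exists n; rewrite (_ : A = A') //; apply/seteqP; split=> x.
    move=> /AE[h]; rewrite inE => /predU1P[->{h}|sh] Bh; last by exists h.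
    by have [h sh Bhg] := A'g; exists h => //; rewrite -(mulVKg g x) mulgA; exact: BM.
  by move=> [h sh Bh]; apply/AE; exists h => //; rewrite inE sh orbT.
exists (n + 1)%N; rewrite (_ : A = A' `|` [set (g * x)%g | x in B]).
  apply: tiledU => //; first exact/tiled_translate/tiled_refl.
  apply/seteqP; split=> // x [[h sh Bh] [u Bu gux]]; apply: A'g; exists h => //.
  rewrite (_ : (_ * _)%g = h^-1 * x * u^-1)%g; first exact/BM/BV.
  by rewrite -gux -!mulgA mulgV mulg1.
apply/seteqP; split=> x.
  move=> /AE[h]; rewrite inE => /predU1P[->{h}|sh] Bh; last by left; exists h.
  by right; exists (g^-1 * x)%g; rewrite ?mulVKg.
move=> [[h sh Bh]|[u Bu <-]]; apply/AE; first by exists h => //; rewrite inE sh orbT.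
by exists g; rewrite ?mem_head ?mulKg.
Qed.

End Tilings.

(** * Topology given by a decreasing sequence of subgroups *)

Section Filtrations.
Variable G : preTopologicalGroupType.
Implicit Types (A B : set G) (U : nat -> set G).

(** Since [preTopologicalGroupType] does not relate topology and product, the neighbourhoods are
    prescribed at every point [g] and not only at the identity. *)
Record filtration U : Prop := {
  filt_subgroup : forall j, subgroup (U j);
  filt_decr : forall j, U j.+1 `<=` U j;
  filt_nbhs : forall g A, nbhs g A <-> exists j, forall u, U j u -> A (g * u)%g }.

Variable U : nat -> set G.
Hypothesis fU : filtration U.

Lemma filt_le i j : (i <= j)%N -> U j `<=` U i.
Proof.
move=> /subnK <-; elim: (j - i)%N => // k IH.
by move=> x; rewrite addSn => /(filt_decr fU); exact: IH.
Qed.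

Lemma filt_coset g j : nbhs g [set x | U j (g^-1 * x)%g].
Proof. by apply/(filt_nbhs fU); exists j => u; rewrite /= mulKg. Qed.

Lemma invariant_open A j : (forall x u, A x -> U j u -> A (x * u)%g) -> open A.
Proof.
move=> AU; rewrite openE => x Ax; apply/(filt_nbhs fU).
by exists j => u; exact: AU.
Qed.

Lemma invariant_closed A j : (forall x u, A x -> U j u -> A (x * u)%g) -> closed A.
Proof.
move=> AU; rewrite -openC; apply: (@invariant_open _ j).
move=> x u nAx Uu Axu; apply: nAx; rewrite -(mulgK u x); apply: AU => //.
by have [_ _] := filt_subgroup fU j; exact.
Qed.

(** Openness gives an index for each point; it also serves the points of the coset around it, so
    compactness yields a uniform one. *)
Lemma compact_open_invariant A : compact A -> open A ->
  exists j, forall x u, A x -> U j u -> A (x * u)%g.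
Proof.
move=> /compact_near_coveringP cA oA.
have [|j _ jP] := cA nat \oo (fun j x => forall u, U j u -> A (x * u)%g) _.
  move=> x Ax; have /(filt_nbhs fU)[j Aj] : nbhs x A by move: oA; rewrite openE => /(_ x Ax).
  exists ([set y | U j (x^-1 * y)%g], [set i | (j <= i)%N]) => /=.
    by split; [exact: filt_coset|exists j].
  move=> [y i] /= [Uy ji] u Uu; rewrite -(mulVKg x (y * u)%g); apply: Aj.
  have [_ UM _] := filt_subgroup fU j.
  by rewrite mulgA; apply: UM => //; exact: filt_le Uu.
by exists j => x u Ax; apply: (jP j _ x Ax) => /=.
Qed.

Lemma compact_covered A j : compact A ->
  exists s : seq G, forall x, A x -> exists2 g, g \in s & U j (g^-1 * x)%g.
Proof.
move=> /compact_near_coveringP cA.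
(* Finite lists directed by inclusion: near [Phi] means for all lists containing a given one, so
   that the near-covering form of compactness produces a single finite list. *)
pose Phi := filter_from [set: seq G] (fun s => [set s' : seq G | {subset s <= s'}]).
have fPhi : Filter Phi.
  apply: filter_from_filter => [|s s' _ _]; first by exists [::].
  exists (s ++ s') => // t st; split=> x sx; apply: st; rewrite mem_cat sx ?orbT //.
have [|s _ sP] := cA _ Phi (fun s x => exists2 g, g \in s & U j (g^-1 * x)%g) _.
  move=> x Ax.
  exists ([set y | U j (x^-1 * y)%g], [set s' : seq G | {subset [:: x] <= s'}]) => /=.
    by split; [exact: filt_coset|exists [:: x]].
  by move=> [y s] /= [Uy sx]; exists x => //; apply: sx; rewrite mem_head.
by exists s => x Ax; apply: (sP s _ x Ax).
Qed.

Lemma compact_open_tiled A : compact A -> open A ->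
  exists j n, tiled (U j) A n.
Proof.
move=> cA oA; have [j Aj] := compact_open_invariant cA oA; exists j.
have [s sP] := compact_covered j cA.
have [B1 BM BV] := filt_subgroup fU j.
have cov : forall t : seq G, exists s' : seq G, forall x,
    (A x /\ exists2 g, g \in t & U j (g^-1 * x)%g) <->
    exists2 g, g \in s' & U j (g^-1 * x)%g.
  elim=> [|g t [s' s'P]]; first by exists [::] => x; split=> [[_ []]|[]].
  have [Ag|nAg] := pselect (A g).
    exists (g :: s') => x; split.
      move=> [Ax [h]]; rewrite inE => /predU1P[->|th] Uh.
        by exists g => //; rewrite mem_head.
      have /s'P[k s'k Uk] : A x /\ exists2 g, g \in t & U j (g^-1 * x)%g.
        by split=> //; exists h.
      by exists k; rewrite // inE s'k orbT.
    move=> [h]; rewrite inE => /predU1P[->|s'h] Uh.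
      split; last by exists g; rewrite ?mem_head.
      by rewrite -(mulVKg g x); exact: Aj.
    have [//|Ax [k tk Uk]] := (s'P x).2; first by exists h.
    by split=> //; exists k; rewrite // inE tk orbT.
  exists s' => x; split=> [[Ax [h]]|/s'P[Ax [k tk Uk]]].
    rewrite inE => /predU1P[->|th] Uh; last by apply/s'P; split=> //; exists h.
    case: nAg; rewrite -(mulgK (g^-1 * x)%g g) mulVKg; apply: Aj => //.
    exact: BV.
  by split=> //; exists k; rewrite // inE tk orbT.
have [s' s'P] := cov s; apply: (@covered_tiled _ _ _ s'); first exact: filt_subgroup.
by move=> x; split=> [Ax|/s'P[]//]; apply/s'P; split=> //; exact: sP.
Qed.

(** An ultrafilter on [U 0] selects one coset at each level, because each coset splits into finitely
    many at the next level. The second hypothesis gives a point common to all the selected cosets,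
    and the ultrafilter converges to it. *)
Lemma filt_compact :
  (forall j, exists n, tiled (U j.+1) (U j) n) ->
  (forall g : nat -> G, (forall j, U j ((g j)^-1 * g j.+1)%g) ->
     exists h, forall j, U j ((g j)^-1 * h)%g) ->
  compact (U 0).
Proof.
move=> tU cU; rewrite compact_ultra => Phi uPhi PhiU.
have U1 j : U j 1%g by have [] := filt_subgroup fU j.
have step j : exists g, Phi [set x | U j (g^-1 * x)%g].
  elim: j => [|j [g Phig]].
    by exists 1%g; apply: filterS PhiU => x; rewrite /= invg1 mul1g.
  have [n [T [r [_ rC _]]]] := tU j.
  apply: contrapT => nPhi.
  have : \forall x \near Phi, forall i, ~ U j.+1 ((g * r i)^-1 * x)%g.
    apply: filter_forall => i.
    have [Phii|//] := in_ultra_setVsetC [set x | U j.+1 ((g * r i)^-1 * x)%g] uPhi.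
    by case: nPhi; exists (g * r i)%g.
  move=> /(filterI Phig) /filter_ex[x [/rC[i Ui]]] /(_ i); apply.
  by rewrite /= invgM -mulgA.
have [g gP] := choice step.
have gU j : U j ((g j)^-1 * g j.+1)%g.
  have [x [/= Ujx Ux]] := filter_ex (filterI (gP j) (gP j.+1)).
  have sU := filt_subgroup fU j; apply: (subgroup_trans sU Ujx).
  by apply: (subgroup_sym sU); exact: (filt_decr fU).
have [h hP] := cU g gU; exists h; split.
  have [x [/= Ux Ux']] := filter_ex (filterI (gP 0%N) PhiU).
  have sU := filt_subgroup fU 0; rewrite -(mul1g h) -invg1.
  have Ux'' : U 0 (1^-1 * x)%g by rewrite invg1 mul1g.
  by apply: (subgroup_trans sU _ (hP 0)); apply: (subgroup_trans sU Ux''); exact: subgroup_sym.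
move=> A /(filt_nbhs fU)[j Aj]; apply: filterS (gP j) => x /= Ux.
rewrite -(mulVKg h x); apply: Aj.
have sU := filt_subgroup fU j; apply: (subgroup_trans sU _ Ux).
exact: subgroup_sym (hP j).
Qed.

End Filtrations.

(** * Haar measures with values in a field *)

Section Haar.
Variables (G : preTopologicalGroupType) (R0 : fieldType) (U : nat -> set G).
Variable idx : nat -> nat.
Hypothesis fU : filtration U.
Hypothesis tU : forall j, tiled (U j.+1) (U j) (idx j).
Hypothesis idx_neq0 : forall j, (idx j)%:R != 0 :> R0.
Implicit Types A B : set G.

Let index j := (\prod_(i < j) idx i)%N.

Let index_neq0 j : (index j)%:R != 0 :> R0.
Proof. by rewrite natr_prod; apply/prodf_neq0 => i _. Qed.

(** The normalisation gives [U 0] volume 1. A relation is used because any level that tiles [A] may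
    serve; refining to a common level shows that the value does not depend on it. *)
Let volume A (x : R0) :=
  exists j n, tiled (U j) A n /\ x = n%:R / (index j)%:R.

Let volume_refine A j k n : (j <= k)%N -> tiled (U j) A n ->
  exists2 m, tiled (U k) A m & m%:R / (index k)%:R = n%:R / (index j)%:R :> R0.
Proof.
move=> /subnK <-; elim: (k - j)%N => [|i IH] An; first by exists n.
have [m Am mE] := IH An; exists (m * idx (i + j))%N.
  by rewrite addSn; apply: tiled_trans Am; exact: tU.
rewrite -mE addSn /index big_ord_recr /= -/(index _) !natrM.
by field; rewrite idx_neq0 index_neq0.
Qed.

Let volume_uniq A x y : volume A x -> volume A y -> x = y.
Proof.
move=> [j [n [An ->]]] [k [m [Am ->]]].
have [n' An' <-] := volume_refine (leq_maxl j k) An.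
have [m' Am' <-] := volume_refine (leq_maxr j k) Am.
by rewrite (tiled_uniq (filt_subgroup fU _) An' Am').
Qed.

Definition haar A : R0 := xget 0 (volume A).

Let haarE A x : volume A x -> haar A = x.
Proof. by move=> Ax; apply: xget_unique => // y Ay; exact: (volume_uniq Ay Ax). Qed.

Let volume_ex A : Defs.compact_open A -> exists x, volume A x.
Proof.
move=> [cA oA]; have [j [n An]] := compact_open_tiled fU cA oA.
by exists (n%:R / (index j)%:R), j, n.
Qed.

Lemma haar_tiled A j n : tiled (U j) A n -> n%:R != 0 :> R0 -> haar A != 0.
Proof.
move=> An n0; rewrite (haarE (x := n%:R / (index j)%:R)); last by exists j, n.
by rewrite mulf_neq0 // invr_neq0.
Qed.

Lemma haar_is_measure : compact (U 0) -> haar_measure haar.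
Proof.
move=> cU; split.
- move=> A B /volume_ex[_ [j [n [An _]]]] /volume_ex[_ [k [m [Bm _]]]] AB.
  have [n' An' _] := volume_refine (leq_maxl j k) An.
  have [m' Bm' _] := volume_refine (leq_maxr j k) Bm.
  have hA : haar A = n'%:R / (index (maxn j k))%:R by apply: haarE; exists (maxn j k), n'.
  have hB : haar B = m'%:R / (index (maxn j k))%:R by apply: haarE; exists (maxn j k), m'.
  rewrite hA hB.
  rewrite -mulrDl -natrD; apply: haarE; eexists _, _; split; last by [].
  exact: tiledU.
- move=> g A /volume_ex[x Ax]; rewrite (haarE Ax); apply: haarE.
  have [j [n [An ->]]] := Ax.
  by exists j, n; split=> //; exact: tiled_translate.
- exists (U 0); last by apply: (@haar_tiled _ 0 1); [exact: tiled_refl|exact: oner_neq0].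
  split=> //; apply: (invariant_open fU (j := 0)).
  by have [_ UM _] := filt_subgroup fU 0.
Qed.

Lemma haar_set0 (mu : set G -> R0) : haar_measure mu -> mu set0 = 0.
Proof.
move=> [muD _ _]; have c0 : Defs.compact_open (set0 : set G).
  by split; [exact: compact0|exact: open0].
by have := muD _ _ c0 c0 (set0I _); rewrite setU0 => /eqP; rewrite addrC -subr_eq subrr => /eqP.
Qed.

End Haar.

(** * Fields with a chain of fractional ideals *)

Section Valuations.
Variables (F : fieldType) (v : F -> int).
Hypothesis vM : forall x y, x != 0 -> y != 0 -> v (x * y) = v x + v y.
Hypothesis vD : forall x y, x != 0 -> y != 0 -> x + y != 0 ->
  Num.min (v x) (v y) <= v (x + y).
Local Notation O := (val_ideal v).

Lemma val1 : v 1 = 0.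
Proof. by apply: (addIr (v 1)); rewrite add0r -vM ?oner_neq0 // mulr1. Qed.

Lemma valV x : x != 0 -> v x^-1 = - v x.
Proof.
move=> x0; apply/eqP; rewrite -subr_eq0 opprK -vM ?invr_eq0 //.
by rewrite mulVf // val1.
Qed.

Lemma valN x : v (- x) = v x.
Proof.
have [->|x0] := eqVneq x 0; first by rewrite oppr0.
have vN1 : v (-1) = 0.
  have : v ((-1) * (-1)) = 0 by rewrite mulrNN mulr1 val1.
  by rewrite vM ?oppr_eq0 ?oner_eq0 //; lia.
by rewrite -mulN1r vM ?oppr_eq0 ?oner_eq0 // vN1 add0r.
Qed.

Lemma valX x n : x != 0 -> v (x ^+ n) = v x *+ n.
Proof.
move=> x0; elim: n => [|n IH]; first by rewrite expr0 val1.
by rewrite exprS vM ?expf_neq0 // IH mulrS.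
Qed.

Lemma ideal0 n : O n 0. Proof. by left. Qed.

Lemma idealP n x : O n x <-> (x != 0 -> n <= v x).
Proof.
split=> [[->|//]|nx]; first by rewrite eqxx.
by have [->|/nx] := eqVneq x 0; [left|right].
Qed.

Lemma idealS m n x : m <= n -> O n x -> O m x.
Proof. by move=> mn [->|nx]; [left|right; exact: le_trans nx]. Qed.

Lemma idealN n x : O n x -> O n (- x).
Proof. by move=> [->|nx]; [left; rewrite oppr0|right; rewrite valN]. Qed.

Lemma idealD n x y : O n x -> O n y -> O n (x + y).
Proof.
move=> [->|nx]; first by rewrite add0r.
move=> [->|ny]; first by rewrite addr0; right.
apply/idealP => xy0.
have [->|x0] := eqVneq x 0; first by rewrite add0r.
have [->|y0] := eqVneq y 0; first by rewrite addr0.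
by apply: le_trans (vD x0 y0 xy0); rewrite le_min nx ny.
Qed.

Lemma idealB n x y : O n x -> O n y -> O n (x - y).
Proof. by move=> nx /idealN; exact: idealD. Qed.

Lemma idealM m n x y : O m x -> O n y -> O (m + n) (x * y).
Proof.
move=> /idealP mx /idealP ny; apply/idealP; rewrite mulf_eq0 negb_or => /andP[x0 y0].
by rewrite vM //; move: (mx x0) (ny y0); lia.
Qed.

Lemma ideal_sum n (I : Type) (s : seq I) (P : pred I) (x : I -> F) :
  (forall i, P i -> O n (x i)) -> O n (\sum_(i <- s | P i) x i).
Proof. by move=> nx; apply: (@big_ind _ (O n)) => //; [exact: ideal0|exact: idealD]. Qed.

Lemma ideal_natr n : O 0 n%:R.
Proof.
elim: n => [|n IH]; first exact: ideal0.
by rewrite -natr1; apply: idealD IH _; right; rewrite val1.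
Qed.

Lemma ideal_mulrn n k x : O n x -> O n (x *+ k).
Proof. by move=> nx; rewrite -mulr_natr -[n]addr0; exact: idealM (ideal_natr k). Qed.

Lemma ideal1n : ~ O 1 1.
Proof. by move=> /idealP; rewrite oner_neq0 val1 => /(_ isT). Qed.

Lemma ideal_bounded (I : finType) (x : I -> F) : exists m : nat, forall i, O (- m%:Z) (x i).
Proof.
exists (\sum_i `|v (x i)|)%N => i; right; rewrite (bigD1 i) //=; lia.
Qed.

(* Adding 1 permutes the q residue classes, so that q has residue 0. *)
Lemma residue_char (T : finType) (r : T -> F) (p f : nat) :
  #|T| = (p ^ f)%N -> (forall i, O 0 (r i)) ->
  (forall x, O 0 x -> exists i, O 1 (x - r i)) ->
  (forall i j x, O 1 (x - r i) -> O 1 (x - r j) -> i = j) ->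
  O 1 p%:R.
Proof.
move=> Tq r0 rC rI.
have /choice[s sP] : forall i, exists j, O 1 (r i + 1 - r j).
  by move=> i; apply: rC; apply: idealD (r0 i) _; right; rewrite val1.
have s_inj : injective s.
  move=> i j sij; have := idealB (sP i) (sP j); rewrite sij => Oij.
  apply: (rI _ _ (r i)); first by rewrite subrr; exact: ideal0.
  by rewrite (_ : r i - r j = r i + 1 - r (s j) - (r j + 1 - r (s j))) //; ring.
have : O 1 (\sum_i (r i + 1 - r (s i))) by apply: ideal_sum => i _.
have sE : \sum_i r (s i) = \sum_i r i by rewrite [RHS](reindex_inj s_inj).
rewrite sumrB sE big_split /= addrAC subrr add0r sumr_const cardT -cardT Tq natrX.
have [-> _|p0 /idealP] := eqVneq (p%:R : F) 0; first exact: ideal0.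
rewrite expf_neq0 // valX // => /(_ isT) vp; right.
by rewrite leNgt; apply/negP => vp0; have := @mulrn_wle0 _ (v p%:R) f; lia.
Qed.

End Valuations.

(* This covers both kinds of fields: a discrete finite field satisfies it with the
   zero valuation, whose ideals are the whole field and 0. *)
Record chain_valuation (F : preTopologicalFieldType) (p : nat) (v : F -> int)
  : Prop := {
  chainM : forall x y, x != 0 -> y != 0 -> v (x * y) = v x + v y;
  chainD : forall x y, x != 0 -> y != 0 -> x + y != 0 ->
    Num.min (v x) (v y) <= v (x + y);
  chain_nbhs : forall (x : F) (A : set F),
    nbhs x A <-> exists n, forall y, val_ideal v n y -> A (x + y);
  chain_complete : forall (u : nat -> F) (a : int),
    (forall j, val_ideal v (a + j%:Z) (u j.+1 - u j)) ->
    exists l, forall j, val_ideal v (a + j%:Z) (l - u j);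
  chain_index : forall n, exists (e : nat) (T : finType) (r : T -> F),
    [/\ #|T| = (p ^ e)%N, forall i, val_ideal v n (r i),
        forall x, val_ideal v n x -> exists i, val_ideal v (n + 1) (x - r i)
      & forall i j x, val_ideal v (n + 1) (x - r i) ->
          val_ideal v (n + 1) (x - r j) -> i = j];
  chain_char : val_ideal v 1 p%:R }.

Lemma finite_chain_valuation (F : preTopologicalFieldType) (p f : nat) :
  discrete_finite_field F (p ^ f) -> chain_valuation p (fun _ : F => 0).
Proof.
move=> [/card_set_bijP[h [h_fun h_inj h_surj]] oF].
have O0 (n : int) x : n <= 0 -> val_ideal (fun _ : F => 0) n x by right.
have O1 (n : int) x : 0 < n -> val_ideal (fun _ : F => 0) n x -> x = 0.
  by move=> n0 [//|]; lia.
have res0 : exists r : 'I_(p ^ f) -> F, (forall x, exists i, x = r i) /\ injective r.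
  have hr : forall i : 'I_(p ^ f), exists x, h x = i.
    by move=> i; have [x _ <-] := h_surj i (ltn_ord i); exists x.
  have [r rP] := choice hr; exists r; split=> [x|i j rij].
    have hx : (h x < p ^ f)%N by exact: h_fun.
    exists (Ordinal hx); apply: h_inj; rewrite ?inE //; by rewrite rP.
  by apply: val_inj; rewrite /= -!rP rij.
split=> //.
- move=> x A; split=> [/nbhs_singleton Ax|[n nA]].
    by exists 1 => y /O1 -> //; rewrite addr0.
  apply: open_nbhs_nbhs; split; first exact: oF.
  by rewrite -(addr0 x); apply: nA; left.
(* From this index on, [a + j] is positive, so the increments lie in the zero ideal and the sequence
   is constant. *)
- move=> u a uc; exists (u `|a|.+1) => j.
  have uS k i : 0 < a + i%:Z -> u (k + i)%N = u i.
    move=> ai; elim: k => // k IH.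
    by rewrite -IH; apply/eqP; rewrite -subr_eq0 (O1 _ _ _ (uc (k + i)%N)) //; lia.
  have [aj|aj] := leP (a + j%:Z) 0; first exact: O0.
  by left; rewrite -(uS j `|a|.+1) ?[(j + _)%N]addnC ?uS ?subrr //; lia.
- move=> n; have [n0|n0] := eqVneq n 0.
    have [r [rC rI]] := res0; exists f, 'I_(p ^ f), r; rewrite n0 card_ord; split=> //.
    + by move=> i; exact: O0.
    + by move=> x _; have [i ->] := rC x; exists i; rewrite subrr; left.
    + move=> i j x xi xj; apply: rI.
      by rewrite -(subr0_eq (O1 _ _ _ xi)) // -(subr0_eq (O1 _ _ _ xj)).
  exists 0%N, unit, (fun=> 0); rewrite card_unit; split=> //.
  + by move=> i; left.
  + move=> x nx; exists tt; rewrite subr0; case: nx => [->|nx]; [by left|right; lia].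
  + by move=> [] [].
- have [r [rC rI]] := res0.
  apply: (@residue_char _ _ _ _ _ r _ f); rewrite ?card_ord //.
  + by move=> i; exact: O0.
  + by move=> x _; have [i ->] := rC x; exists i; rewrite subrr; left.
  + move=> i j x xi xj; apply: rI.
      by rewrite -(subr0_eq (O1 _ _ _ xi)) // -(subr0_eq (O1 _ _ _ xj)).
Qed.


Lemma local_chain_valuation (F : preTopologicalFieldType) (p f : nat) :
  nonarch_local_field F (p ^ f) -> exists v : F -> int, chain_valuation p v.
Proof.
move=> [v [[vM vD [w w0 vw]] vN vC [r [r0 rP]]]]; exists v.
have vE (n : int) : exists2 y : F, y != 0 & v y = n.
  case: n => n; first by exists (w ^+ n); rewrite ?expf_neq0 // valX // vw -mulr_natl mulr1 natz.
  exists (w ^- n.+1); rewrite ?invr_neq0 ?expf_neq0 //.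
  by rewrite valV ?expf_neq0 // valX // vw NegzE -mulr_natl mulr1 natz.
have rI i j x : val_ideal v 1 (x - r i) -> val_ideal v 1 (x - r j) -> i = j.
  move=> xi xj; have x0 : val_ideal v 0 x.
    by rewrite -(subrK (r i) x); apply: idealD => //; exact: idealS xi.
  by have [k [_ kU]] := rP x x0; rewrite -(kU _ xi) -(kU _ xj).
have rC x : val_ideal v 0 x -> exists i, val_ideal v 1 (x - r i).
  by move=> /rP[i [xi _]]; exists i.
split=> //.
- move=> x A; rewrite vN; split=> -[n nA]; exists n.
    by move=> y ny; apply: nA; rewrite /= addrC addKr.
  by move=> y /= /nA; rewrite addrC subrK.
- move=> u a uP.
  have uk j k : (j <= k)%N -> val_ideal v (a + j%:Z) (u k - u j).
    move=> /subnK <-; elim: (k - j)%N => [|i IH]; first by rewrite subrr; left.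
    rewrite addSn -(subrKA (u (i + j)%N)); apply: idealD => //.
    by apply: idealS (uP _); lia.
  have [|l ul] := vC u.
    move=> n; exists `|n - a|%N => i j ni nj.
    rewrite -(subrKA (u `|n - a|%N)); apply: idealD => //.
      by apply: idealS (uk _ _ ni); lia.
    rewrite -opprB; apply: idealN => //.
    by apply: idealS (uk _ _ nj); lia.
  exists l => j.
  have /ul[N _ NP] : nbhs l [set x | val_ideal v (a + j%:Z) (x - l)].
    by apply/vN; exists (a + j%:Z).
  have /= lN := NP (maxn N j) (leq_maxl _ _).
  rewrite -(subrKA (u (maxn N j))) -(opprB _ l).
  by apply: idealD => //; [exact: idealN|exact: uk (leq_maxr _ _)].
(* Multiplication by [y] shifts the chain of ideals by [n], so it carries residue representatives to
   representatives of the ideal of index [n] modulo the next one. *)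
- move=> n; have [y y0 yn] := vE n.
  have Oy m x : val_ideal v (n + m) (y * x) <-> val_ideal v m x.
    split=> [nx|mx]; last by apply: idealM => //; right; rewrite yn.
    rewrite -(mulKf y0 x) -(addKr n m); apply: idealM => //.
    by right; rewrite valV // yn.
  exists f, 'I_(p ^ f), (fun i => y * r i); rewrite card_ord; split=> //.
  + by move=> i; rewrite -[n]addr0; apply/Oy.
  + move=> x; rewrite -{1}(mulVKf y0 x) -{1}[n]addr0 => /Oy/rC[i xi]; exists i.
    by rewrite -(mulVKf y0 x) -mulrBr; apply/Oy.
  + move=> i j x; rewrite -{1 2}(mulVKf y0 x) -!mulrBr => /Oy xi /Oy xj.
    exact: rI xi xj.
- by apply: (@residue_char _ _ _ _ 'I_(p ^ f) r _ f); rewrite ?card_ord.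
Qed.

(** * Lattices in the Heisenberg group *)

Section Lattices.
Variables (F : preTopologicalFieldType) (p : nat) (v : F -> int).
Hypothesis ch : chain_valuation p v.
Variables (W : vectType F) (form : {skew_symmetric W}).
Local Notation O := (val_ideal v).
Local Notation H := (heisenberg form).
Local Notation d := (\dim {:W}).
Local Notation cd i w := (coord (vbasis {:W}) i w).
Local Notation b := (vbasis {:W}).
Let vM := chainM ch.
Let vD := chainD ch.

Lemma chain_split n n' : n <= n' -> exists (e : nat) (T : finType) (r : T -> F),
  [/\ #|T| = (p ^ e)%N, forall i, O n (r i),
      forall x, O n x -> exists i, O n' (x - r i)
    & forall i j x, O n' (x - r i) -> O n' (x - r j) -> i = j].
Proof.
move=> nn'; have -> : n' = n + `|n' - n|%N%:Z by lia.
elim: `|n' - n|%N => [|k [e [T [r [Te rn rC rI]]]]].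
  exists 0%N, unit, (fun=> 0); rewrite card_unit; split=> //.
  - by move=> i; exact: ideal0.
  - by move=> x nx; exists tt; rewrite [x - 0]subr0; apply: idealS nx; lia.
  - by move=> [] [].
have [e' [T' [r' [Te' rn' rC' rI']]]] := chain_index ch (n + k%:Z).
have -> : n + k.+1%:Z = n + k%:Z + 1 by lia.
exists (e + e')%N, (T * T')%type, (fun i => r i.1 + r' i.2); split.
- by rewrite card_prod Te Te' expnD.
- by move=> i; apply: idealD => //; apply: idealS (rn' i.2); lia.
- move=> x /rC[i /rC'[j xij]]; exists (i, j).
  by rewrite opprD addrA.
- move=> [i i'] [j j'] x; rewrite /= !opprD !addrA => xi xj.
  have ij : i = j.
    apply: (rI _ _ x).
      rewrite -(subrK (r' i') (x - r i)); apply: idealD => //.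
      by apply: idealS xi; lia.
    rewrite -(subrK (r' j') (x - r j)); apply: idealD => //.
    by apply: idealS xj; lia.
  by subst j; rewrite (rI' _ _ _ xi xj).
Qed.

Definition lattice (a : int) (w : W) := forall i, O a ((cd i w)).

Lemma lattice0 a : lattice a 0.
Proof. by move=> i; rewrite linear0; exact: ideal0. Qed.

Lemma latticeS a a' w : a <= a' -> lattice a' w -> lattice a w.
Proof. by move=> aa' wa i; exact: idealS (wa i). Qed.

Lemma latticeD a w w' : lattice a w -> lattice a w' -> lattice a (w + w').
Proof. by move=> wa wa' i; rewrite linearD; exact: idealD (wa i) (wa' i). Qed.

Lemma latticeN a w : lattice a w -> lattice a (- w).
Proof. by move=> wa i; rewrite linearN; exact: idealN (wa i). Qed.

Lemma lattice_bounded w : exists m : nat, lattice (- m%:Z) w.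
Proof. exact: (ideal_bounded v (fun i => (cd i w))). Qed.

Lemma basisE w : w = \sum_i (cd i w) *: b`_i.
Proof. by apply: coord_vbasis; rewrite memvf. Qed.

(** The constant bounds the entries of half the Gram matrix of the chosen basis; bilinearity does
    the rest. *)
Lemma pairing_bound : exists m : int, forall a a' w w',
  lattice a w -> lattice a' w' -> O (a + a' + m) (2^-1 * form w w').
Proof.
have [m mP] := ideal_bounded v (fun ij : 'I_d * 'I_d => 2^-1 * form b`_ij.1 b`_ij.2).
exists (- m%:Z) => a a' w w' wa wa'.
rewrite (basisE w) linear_sumlz mulr_sumr; apply: ideal_sum => // i _.
rewrite (basisE w') linear_sumr mulr_sumr; apply: ideal_sum => // j _.
rewrite linearZl_LR linearZr_LR /=.
rewrite (_ : 2^-1 * _ = (cd i w) * (cd j w') * (2^-1 * form b`_i b`_j)); last first.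
  by rewrite -!mulrA mulrCA; congr (_ * _); rewrite mulrCA.
by apply: idealM (mP (i, j)) => //; exact: idealM.
Qed.

Lemma lattice_split a a' : a <= a' -> exists (e : nat) (T : finType) (r : T -> W),
  [/\ #|T| = (p ^ e)%N, forall i, lattice a (r i),
      forall w, lattice a w -> exists i, lattice a' (w - r i)
    & forall i j w, lattice a' (w - r i) -> lattice a' (w - r j) -> i = j].
Proof.
move=> /chain_split[e [T [r [Te ra rC rI]]]].
have rE (s : {ffun 'I_d -> T}) i : cd i (\sum_j r (s j) *: b`_j) = r (s i).
  by rewrite coord_sum_free ?(basis_free (vbasisP _)).
exists (e * d)%N, {ffun 'I_d -> T}, (fun s : {ffun 'I_d -> T} => \sum_j r (s j) *: b`_j); split.
- by rewrite card_ffun card_ord Te expnM.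
- by move=> s i /=; rewrite rE; exact: ra.
- move=> w wa; have /choice[s sP] i := rC _ (wa i).
  by exists (finfun s) => i; rewrite linearB /= rE ffunE; exact: sP.
- move=> s s' w ws ws'; apply/ffunP => i; apply: (rI _ _ ((cd i w))).
    by rewrite -(rE s) -linearB; exact: (ws i).
  by rewrite -(rE s') -linearB; exact: (ws' i).
Qed.

(** The topology comes from coordinates, so its basic neighbourhoods are additive boxes; they are
    compared with translates for the group law in [heis_lattice_filtration]. *)
Lemma heis_nbhsP (g : H) (A : set H) : nbhs g A <->
  exists n : int, forall h : H, lattice n (h.1 - g.1) -> O n (h.2 - g.2) -> A h.
Proof.
split.
  rewrite nbhsE => -[_ [[B oB <-] Bg] BA].
  have : nbhs (heis_coord g) B by apply: open_nbhs_nbhs; split.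
  move=> [[P Q] /= [[M nM MP] /(chain_nbhs ch)[n nQ]] PQB].
  have /choice[k kP] : forall i, exists n, forall y, O n y -> M ord0 i ((cd i g.1) + y).
    move=> i; have := nM ord0 i; rewrite /heis_coord /= mxE.
    by move/(chain_nbhs ch).
  exists (`|n| + \sum_i `|k i|)%N%:Z => h hg1 hg2; apply: BA; apply: PQB; split=> /=.
    apply: MP => i j; rewrite ord1 mxE -(subrK ((cd j g.1)) ((cd j h.1))) addrC; apply: kP.
    rewrite -linearB; apply: idealS (hg1 j).
    by rewrite (bigD1 j) //=; lia.
  rewrite -(subrK g.2 h.2) addrC; apply: nQ; apply: idealS hg2.
  lia.
move=> [n nA].
have : nbhs g (heis_coord (form := form) @^-1`
    ([set M : 'rV[F]_d | forall i, O n (M ord0 i - (cd i g.1))] `*` [set t | O n (t - g.2)])).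
  apply: (@initial_continuous _ _ (heis_coord (form := form)) g).
  exists ([set M : 'rV[F]_d | forall i, O n (M ord0 i - (cd i g.1))], [set t | O n (t - g.2)]) => //=.
  split; last by apply/(chain_nbhs ch); exists n => y; rewrite /= addrC addKr.
  exists (fun _ i => [set t | O n (t - (cd i g.1))]) => [i j|M MP i]; last exact: MP.
  by rewrite ord1 mxE; apply/(chain_nbhs ch); exists n => y; rewrite /= addrC addKr.
apply: filterS => h [/= h1 h2]; apply: nA => // i.
by rewrite linearB; have := h1 i; rewrite mxE.
Qed.

End Lattices.

(** * Compact open subgroups of the Heisenberg group built from lattices *)

Section LatticeSubgroups.
Variables (F : preTopologicalFieldType) (p : nat) (v : F -> int).
Hypothesis ch : chain_valuation p v.
Variables (W : vectType F) (form : {skew_symmetric W}) (m : int).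
Local Notation O := (val_ideal v).
Local Notation L := (lattice v).
Local Notation H := (heisenberg form).
Hypothesis pairing : forall a a' w w',
  L a w -> L a' w' -> O (a + a' + m) (2^-1 * form w w').
Let vM := chainM ch.
Let vD := chainD ch.

Lemma heisM (x y : H) :
  (x * y)%g = (x.1 + y.1, x.2 + y.2 + 2^-1 * form x.1 y.1) :> H.
Proof. by []. Qed.

Lemma heisV (x : H) : (x^-1)%g = (- x.1, - x.2 + 2^-1 * form x.1 x.1) :> H.
Proof. by []. Qed.

(** In this form the correction to the central coordinate depends on [y.1 - x.1], so it is small
    when the components in [W] are close. *)
Lemma heis_div (x y : H) :
  (x^-1 * y)%g = (y.1 - x.1, y.2 - x.2 - 2^-1 * form x.1 (y.1 - x.1)) :> H.
Proof.
rewrite heisM heisV /=; congr pair; first by rewrite addrC.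
by rewrite linearB linearNl /=; ring.
Qed.

Definition heis_lattice (a b : int) : set H := [set x | L a x.1 /\ O b x.2].

(** This is the condition for the cocycle to map pairs from the lattice of level [a] into the ideal
    of level [b], which makes [heis_lattice a b] a subgroup. *)
Definition good (a b : int) := b <= a + a + m.

Lemma good_shift a b (j : nat) : good a b -> good (a + j%:Z) (b + j%:Z).
Proof. rewrite /good; lia. Qed.

Lemma heis_lattice_sub a a' b b' : a <= a' -> b <= b' ->
  heis_lattice a' b' `<=` heis_lattice a b.
Proof. by move=> aa' bb' x [xa xb]; split; [exact: latticeS xa|exact: idealS xb]. Qed.

Lemma heis_lattice_subgroup a b : good a b -> subgroup (heis_lattice a b).
Proof.
move=> gab; split.
- by split; [exact: lattice0|exact: ideal0].
- move=> x y [xa xb] [ya yb]; split; rewrite heisM /=; first exact: (latticeD ch).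
  by apply: idealD => //; [exact: idealD|apply: idealS (pairing xa ya)].
- move=> x [xa xb]; split; rewrite heisV /=; first exact: (latticeN ch).
  by apply: idealD => //; [exact: idealN|apply: idealS (pairing xa xa)].
Qed.

Lemma heis_lattice_tiled a a' b b' : good a b -> a <= a' -> b <= b' ->
  exists e, tiled (heis_lattice a' b') (heis_lattice a b) (p ^ e).
Proof.
move=> gab aa' bb'.
have [e [T [r [Te ra rC rI]]]] := lattice_split ch W aa'.
have [e' [T' [r' [Te' rb rC' rI']]]] := chain_split ch bb'.
exists (e + e')%N, (T * T')%type, (fun i => (r i.1, r' i.2) : H); split.
- by rewrite card_prod Te Te' expnD.
- move=> x; split.
    move=> [/[dup] xa /rC[i xi] xb].
    (* The representative in [W] is chosen before the central one, which must approximate the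
       central coordinate left after division by [(r i, 0)]. *)
    have [j xj] : exists j, O b' (x.2 - 2^-1 * form (r i) (x.1 - r i) - r' j).
      apply: rC'; apply: idealB => //; exact: idealS (pairing (ra i) (latticeS aa' xi)).
    by exists (i, j); rewrite heis_div; split => //=; rewrite addrAC.
  move=> [[i j]] xij; have sg := heis_lattice_subgroup gab.
  apply/(subgroup_divl _ sg); last by apply: heis_lattice_sub xij.
  by split; [exact: ra|exact: rb].
- move=> [i i'] [j j'] x; rewrite !heis_div => -[/= xi xi'] [/= xj xj'].
  have ij : i = j by exact: rI xi xj.
  subst j; congr pair; apply: (rI' _ _ (x.2 - 2^-1 * form (r i) (x.1 - r i))).
    by rewrite addrAC.
  by rewrite addrAC.
Qed.

Lemma heis_lattice_filtration a b : good a b ->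
  filtration (fun j : nat => heis_lattice (a + j%:Z) (b + j%:Z)).
Proof.
move=> gab; split.
- by move=> j; exact/heis_lattice_subgroup/good_shift.
- by move=> j; apply: heis_lattice_sub; lia.
- move=> g A; have [k gk] := lattice_bounded v g.1; rewrite (heis_nbhsP ch); split.
    (* The last summand handles the twist by [g]: the cocycle of [g.1], of level [- k], with [u.1],
       of level [a + j], must reach level [n]. *)
    move=> [n nA]; exists (`|(n - a)%R| + `|(n - b)%R| + `|(n + k%:Z - a - m)%R|)%N => u [ua ub].
    apply: nA; rewrite heisM /=.
      by rewrite addrC addrA addNr add0r; apply: latticeS ua; lia.
    rewrite (_ : _ - g.2 = u.2 + 2^-1 * form g.1 u.1); last by ring.
    apply: idealD => //.
      by apply: idealS ub; lia.
    by apply: idealS (pairing gk ua); lia.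
  move=> [j jA]; exists (`|a| + `|b| + j + k + `|m|)%N%:Z => h ha hb.
  rewrite -(mulVKg g h); apply: jA; rewrite heis_div; split=> /=.
    by apply: latticeS ha; lia.
  apply: idealB => //; first by apply: idealS hb; lia.
  by apply: idealS (pairing gk ha); lia.
Qed.

Lemma heis_lattice_compact a b : good a b -> compact (heis_lattice a b).
Proof.
move=> gab; have fab := heis_lattice_filtration gab.
have -> : heis_lattice a b = heis_lattice (a + 0%N%:Z) (b + 0%N%:Z) by rewrite !addr0.
apply: (filt_compact fab) => [j|g gP].
  have [e eP] : exists e, tiled (heis_lattice (a + j.+1%:Z) (b + j.+1%:Z))
      (heis_lattice (a + j%:Z) (b + j%:Z)) (p ^ e).
    by apply: heis_lattice_tiled; [exact: good_shift|lia|lia].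
  by exists (p ^ e)%N.
have [w wP] : exists w, forall j : nat, L (a + j%:Z) (w - (g j).1).
  have /choice[l lP] : forall i, exists l, forall j : nat,
      O (a + j%:Z) (l - coord (vbasis {:W}) i (g j).1).
    move=> i; apply: (chain_complete ch) => j; have := gP j.
    by rewrite heis_div -linearB => -[/(_ i)].
  exists (\sum_i l i *: (vbasis {:W})`_i) => j i.
  by rewrite linearB /= coord_sum_free ?(basis_free (vbasisP _)).
(* With this choice [t - s j] is the central coordinate of [(g j)^-1 * (w, t)]. The increments of
   [s] have exactly the required size, whereas those of [(g j).2] alone need not. *)
pose s j := (g j).2 + 2^-1 * form (g j).1 (w - (g j).1).
have [t tP] : exists t, forall j : nat, O (b + j%:Z) (t - s j).
  apply: (chain_complete ch) => j; have := gP j; rewrite heis_div => -[/= g1 g2].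
  rewrite (_ : s j.+1 - s j = ((g j.+1).2 - (g j).2 - 2^-1 * form (g j).1 ((g j.+1).1 - (g j).1)) +
    2^-1 * form ((g j.+1).1 - (g j).1) (w - (g j.+1).1)).
    apply: idealD => //; apply: idealS (pairing g1 (wP j.+1)).
    by move: gab; rewrite /good; lia.
  by rewrite /s linearBl /= !linearB /=; ring.
exists (w, t) => j; rewrite heis_div; split=> //=.
by have := tP j; rewrite /s opprD addrA.
Qed.

End LatticeSubgroups.

(** * The orthogonal of a lattice under the character *)

Section Perp.
Variables (F : preTopologicalFieldType) (p : nat) (v : F -> int).
Hypothesis ch : chain_valuation p v.
Variables (W : vectType F) (form : {skew_symmetric W}).
Hypothesis form_nondeg : nondegenerate form.
Variables (K : fieldType) (psi : F -> K).
Hypothesis psi_smooth : smooth_character psi.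
Hypothesis psi_nontrivial : exists x, psi x != 1.
Local Notation O := (val_ideal v).
Local Notation L := (lattice v).
Local Notation d := (\dim {:W}).
Local Notation b := (vbasis {:W}).
Let vM := chainM ch.
Let vD := chainD ch.

Let gram : 'M[F]_d := \matrix_(i, j) form b`_i b`_j.

Let form_gram w (j : 'I_d) : form w b`_j = ((\row_i coord b i w) *m gram) 0 j.
Proof.
rewrite mxE {1}(basisE w) linear_sumlz; apply: eq_bigr => i _.
by rewrite !mxE linearZl_LR.
Qed.

Let gram_unit : gram \in unitmx.
Proof.
rewrite -row_free_unit; apply: inj_row_free => c cG.
pose w := \sum_i c 0 i *: b`_i.
have wc i : coord b i w = c 0 i by rewrite coord_sum_free ?(basis_free (vbasisP _)).
have cE : \row_i coord b i w = c by apply/rowP => i; rewrite mxE wc.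
suff w0 : w = 0 by rewrite -cE w0; apply/rowP => i; rewrite !mxE linear0.
apply/eqP; rewrite -memv0 -(eqP form_nondeg); apply/mem_orthovP => u _.
rewrite (basisE u) linear_sumr big1 // => j _.
by rewrite linearZr_LR /= form_gram cE cG mxE mulr0.
Qed.

(** If some [form w b_j] had valuation below [v x0 - k], a multiple of the basis vector [b_j] inside
    the lattice would pair with [w] to [x0], where [psi] is not 1. The inverse Gram matrix turns
    this bound into one on the coordinates of [w]. *)
Lemma perp_bounded (k : int) : exists m : nat, forall w,
  (forall l, L k l -> psi (form w l) = 1) -> L (- m%:Z) w.
Proof.
have [x0 x01] := psi_nontrivial.
have [psi0 _ _] := psi_smooth.
have x0n0 : x0 != 0 by apply: contraNneq x01 => ->; rewrite psi0.
have [m mP] := ideal_bounded v (fun ij : 'I_d * 'I_d => invmx gram ij.1 ij.2).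
exists (m + `|(v x0 - k)%R|)%N => w wP i.
have wb (j : 'I_d) : O (v x0 - k) (form w b`_j).
  apply/idealP => y0; rewrite leNgt; apply/negP => yk; case/eqP: x01.
  have <- : form w ((x0 / form w b`_j) *: b`_j) = x0.
    by rewrite linearZr_LR /= mulfVK.
  apply: wP => l.
  rewrite linearZ /= coord_free ?(basis_free (vbasisP _)) //.
  case: (_ == _); rewrite ?mulr1 ?mulr0; last exact: ideal0.
  by right; rewrite vM ?invr_neq0 // (valV vM y0); lia.
have -> : coord b i w = ((\row_i coord b i w) *m gram *m invmx gram) 0 i.
  by rewrite mulmxK // mxE.
rewrite mxE; apply: ideal_sum => // j _; rewrite -form_gram.
by apply: idealS (idealM vM (wb j) (mP (j, i))); lia.
Qed.

End Perp.

(** * Roots of unity of p-power order among the values of the character *)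

Lemma primitive_root_pfactor (K : fieldType) (p n : nat) (z : K) : prime p ->
  z ^+ (p ^ n.+1) = 1 -> z ^+ (p ^ n) != 1 -> (p ^ n.+1).-primitive_root z.
Proof.
move=> p_pr zp zn; have pn : (0 < p ^ n.+1)%N by rewrite expn_gt0 prime_gt0.
have [k kz /(dvdn_pfactor _ _ p_pr)[j jn kj]] := prim_order_exists pn zp.
move: jn kz; rewrite kj leq_eqVlt => /predU1P[-> //|]; rewrite ltnS => jn kz.
by case/eqP: zn; apply/eqP; rewrite -(prim_order_dvd kz) dvdn_exp2l.
Qed.

Section Torsion.
Variables (F : preTopologicalFieldType) (p : nat) (v : F -> int).
Hypothesis p_prime : prime p.
Hypothesis ch : chain_valuation p v.
Variables (K : fieldType) (psi : F -> K).
Hypothesis psi_smooth : smooth_character psi.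
Hypothesis psi_nontrivial : exists x, psi x != 1.
Local Notation O := (val_ideal v).
Local Notation L := (lattice v).
Let vM := chainM ch.
Let vD := chainD ch.

Lemma psiMn x n : psi (x *+ n) = psi x ^+ n.
Proof.
have [psi0 psiD _] := psi_smooth.
by elim: n => [|n IH]; rewrite ?mulr0n ?psi0 // mulrS psiD IH exprS.
Qed.

Lemma psi_neq0 x : psi x != 0.
Proof.
have [psi0 psiD _] := psi_smooth.
apply/eqP => px; have := oner_neq0 K.
by rewrite -psi0 -(subrr x) psiD px mul0r eqxx.
Qed.

Lemma psiN x : psi (- x) = (psi x)^-1.
Proof.
have [psi0 psiD _] := psi_smooth.
by apply: (mulfI (psi_neq0 x)); rewrite -psiD subrr psi0 divff ?psi_neq0.
Qed.

Lemma ideal_pfactor a x n : O a x -> O (a + n%:Z) (x *+ (p ^ n)).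
Proof.
move=> ax; elim: n => [|n IH]; first by apply: idealS ax; lia.
rewrite expnSr mulrnA -mulr_natr.
by apply: idealS (idealM vM IH (chain_char ch)); lia.
Qed.

Lemma lattice_pfactor (W : vectType F) a (w : W) n :
  L a w -> L (a + n%:Z) (w *+ (p ^ n)).
Proof. by move=> wa i; rewrite linearMn; exact: (ideal_pfactor n (wa i)). Qed.

(** Smoothness makes [psi] trivial on high multiples [x0 *+ p ^ s]. The least such exponent is the
    exponent of the order of [psi x0], and dividing [x0] by [p ^ j] raises it by [j]. *)
Lemma psi_primitive : p%:R != 0 :> F ->
  forall j, exists n x, (j <= n)%N /\ (p ^ n).-primitive_root (psi x).
Proof.
move=> p0 j; have [x0 x01] := psi_nontrivial.
have [psi0 psiD psiC] := psi_smooth.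
have : nbhs 0 (psi @^-1` [set 1]) by apply: open_nbhs_nbhs; split; [exact: psiC|].
move=> /(chain_nbhs ch)[c cP].
have ex : exists s, psi (x0 *+ (p ^ s)) == 1.
  exists `|(c - v x0)%R|%N; apply/eqP; rewrite -[_ *+ _]add0r; apply: cP.
  have x0v : O (v x0) x0 by right.
  by apply: idealS (ideal_pfactor _ x0v); lia.
case: (ex_minnP ex) => -[|s] /eqP sP sm; first by rewrite -(mulr1n x0) sP eqxx in x01.
have xE t : (x0 / p%:R ^+ j) *+ (p ^ (t + j)) = x0 *+ (p ^ t).
  by rewrite expnD mulrnA -[LHS]mulr_natr natrX mulrnAl mulfVK ?expf_neq0.
exists (s.+1 + j)%N, (x0 / p%:R ^+ j); split; first exact: leq_addl.
apply: (@primitive_root_pfactor _ _ (s + j)) => //.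
  by rewrite -psiMn -addSn xE.
by rewrite -psiMn xE; apply: contraL (ltnSn s) => /sm; rewrite -leqNgt.
Qed.

Lemma psi_primitive_char : p%:R = 0 :> F -> exists x, p.-primitive_root (psi x).
Proof.
move=> p0; have [x0 x01] := psi_nontrivial; have [psi0 _ _] := psi_smooth.
exists x0; rewrite -(expn1 p); apply: primitive_root_pfactor => //.
by rewrite expn1 -psiMn -mulr_natr p0 mulr0.
Qed.

(** One exponent has to serve two purposes: to shrink a lattice and to be realised as an order. When
    [p] vanishes in [F] it kills [W], so 1 is enough; otherwise the available orders are
    unbounded. *)
Lemma torsion_root (W : vectType F) a k : exists n x,
  (forall w : W, L a w -> L k (w *+ (p ^ n))) /\ (p ^ n).-primitive_root (psi x).
Proof.
have [p0|p0] := eqVneq (p%:R : F) 0.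
  have [x px] := psi_primitive_char p0; exists 1%N, x; split=> //= w _.
  by rewrite expn1 -scaler_nat p0 scale0r; exact: lattice0.
have [n [x [nk px]]] := psi_primitive p0 `|(k - a)%R|%N; exists n, x; split=> // w wa.
by apply: latticeS (lattice_pfactor n wa); lia.
Qed.

End Torsion.

(** * Enlarging a subgroup by one step of index p *)

Section CyclicExtension.
Variables (G : groupType) (U : set G) (g : G) (p : nat).
Hypotheses (p_prime : prime p) (sU : subgroup U).
Hypothesis norm_g : forall u, U u -> U (u ^ g)%g.
Hypotheses (gpU : U (g ^+ p)%g) (gnU : ~ U g).

Definition cyclic_extension := [set x | exists i, U (g ^- i * x)%g].
Local Notation U' := cyclic_extension.

Let norm_gn u i : U u -> U (u ^ (g ^+ i))%g.
Proof.
move=> Uu; elim: i => [|i IH]; first by rewrite conjg1.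
by rewrite expgSr conjgM; exact: norm_g.
Qed.

Let subgroupX x i : U x -> U (x ^+ i)%g.
Proof.
by have [U1 UM _] := sU; move=> Ux; elim: i => // i IH; rewrite expgS; exact: UM.
Qed.

(** A Bezout relation between [k] and [p] would put [g] itself in [U]; this makes the index exactly
    [p]. *)
Let expg_notin k : (0 < k)%N -> (k < p)%N -> ~ U (g ^+ k)%g.
Proof.
move=> k0 kp gk; have cpk : coprime k p.
  by rewrite coprime_sym prime_coprime // gtnNdvd.
have /(coprimeP _ k0)[[a b] /= ab] := cpk.
have [_ UM UV] := sU.
apply: gnU; rewrite -(expg1 g) -ab expgnFr; last by lia.
rewrite mulnC expgnA (mulnC b) expgnA; apply: UM; first exact: subgroupX.
exact/UV/subgroupX.
Qed.

Lemma cyclic_extension_sub : U `<=` U'.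
Proof. by move=> x Ux; exists 0%N; rewrite expg0 invg1 mul1g. Qed.

Lemma cyclic_extension_subgroup : subgroup U'.
Proof.
have [U1 UM UV] := sU; split; first exact: cyclic_extension_sub.
  move=> x y [i xi] [j yj]; exists (i + j)%N.
  rewrite (_ : (_ * _)%g = (g ^- i * x) ^ (g ^+ j) * (g ^- j * y))%g.
    by apply: UM => //; exact: norm_gn.
  by rewrite conjgE expgnDr invgM -!mulgA mulVKg.
(* Exponents are natural numbers, so [- i] is replaced by [i * (p - 1)], which differs from it by
   [p * i], and [g ^+ p] lies in [U]. *)
move=> x [i xi]; exists (i * p.-1)%N.
rewrite (_ : (_ * _)%g = ((g ^- i * x)^-1) ^ (g ^+ (i * p.-1)) * ((g ^+ p) ^- i))%g.
  by apply: UM; [exact/norm_gn/UV|exact/UV/subgroupX].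
rewrite -expgnA conjgE invgM invgK -!mulgA; congr (_ * _)%g.
rewrite [(g ^+ i * _)%g]mulgA -expgnDr (_ : (i + _)%N = (p * i)%N) ?mulgV ?mulg1 //.
by have := prime_gt0 p_prime; case: (p) => // q _; rewrite /= mulSn mulnC.
Qed.

Lemma cyclic_extension_tiled : tiled U U' p.
Proof.
have [U1 UM UV] := sU; exists 'I_p, (fun i : 'I_p => (g ^+ i)%g); split.
- by rewrite card_ord.
- move=> x; split=> [[i xi]|[i xi]]; last by exists i.
  have ip : (i %% p < p)%N by rewrite ltn_mod prime_gt0.
  exists (Ordinal ip) => /=.
  rewrite (_ : (_ * _)%g = ((g ^+ p) ^+ (i %/ p)) * (g ^- i * x))%g.
    by apply: UM => //; exact: subgroupX.
  rewrite mulgA; congr (_ * _)%g; rewrite -expgnA mulnC.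
  by rewrite {3}(divn_eq i p) addnC expgnDr invgM mulVKg.
- suff wlog : forall (i j : nat) x, (i <= j)%N -> (j < p)%N ->
      U (g ^- i * x)%g -> U (g ^- j * x)%g -> i = j.
    move=> i j x xi xj; apply: val_inj => /=; case: (leqP i j) => ij.
      exact: (wlog i j x).
    by apply/esym; apply: (wlog j i x) => //; exact: ltnW.
  move=> i j x; rewrite leq_eqVlt => /predU1P[//|ij] jp xi xj.
  have : U (g ^+ (j - i))%g.
    rewrite expgnFr; last exact: ltnW.
    rewrite (_ : (_ / _)%g = (g ^- i * x) * (g ^- j * x)^-1)%g; first exact/UM/UV.
    rewrite invgM invgK mulgA mulgK; apply: (mulgI (g ^+ i)%g); rewrite mulVKg.
    by rewrite mulgA -expgnDr addnC expgnDr mulgK.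
  by move/expg_notin; case; [lia|exact: leq_ltn_trans (leq_subr _ _) jp].
Qed.

End CyclicExtension.

(** * The line of fixed vectors *)

Section Eigenvectors.
Variables (G : groupType) (K : fieldType) (V : lmodType K).
Variable rho : representation G K V.

Lemma rep_actX g n x : rho g x = x -> rho (g ^+ n)%g x = x.
Proof.
move=> gx; elim: n => [|n IH]; first by rewrite expg0 rep_act1.
by rewrite expgS rep_actM IH.
Qed.

(** Discrete Fourier analysis: [e i] is [n] times the component of [x] for the eigenvalue [z ^+ i].
    The [e i] add up to [n%:R *: x], the other terms being geometric sums of nontrivial roots of
    unity, so one of them is nonzero. *)
Lemma rep_eigenvector (P : set V) (g : G) (n : nat) (z : K) (x : V) :
  n.-primitive_root z -> n%:R != 0 :> K ->
  P 0 -> (forall y y', P y -> P y' -> P (y + y')) ->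
  (forall a y, P y -> P (a *: y)) -> (forall y, P y -> P (rho g y)) ->
  P x -> x != 0 -> rho (g ^+ n)%g x = x ->
  exists y i, [/\ y != 0, P y & rho g y = z ^+ i *: y].
Proof.
move=> zn n0 P0 PD PZ Pg Px x0 gnx.
have z0 : z != 0.
  apply/eqP => z0; have /eqP := prim_expr_order zn.
  by rewrite z0 expr0n gtn_eqF ?(prim_order_gt0 zn) // eq_sym oner_eq0.
have zi0 i : z ^+ i != 0 by rewrite expf_neq0.
pose e i := \sum_(0 <= j < n) z ^- (i * j) *: rho (g ^+ j)%g x.
have [i ei] : exists i, e i != 0.
  apply/not_existsP => e0.
  have : \sum_(0 <= i < n) e i = n%:R *: x.
    rewrite exchange_big_nat /= big_ltn ?(prim_order_gt0 zn) //.
    rewrite [X in _ + X]big1_seq ?addr0.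
      under eq_bigr do rewrite muln0 expr0 invr1 scale1r expg0 rep_act1.
      by rewrite sumr_const_nat subn0 scaler_nat.
    move=> j; rewrite mem_index_iota => /andP[_ /andP[j0 jn]].
    rewrite -scaler_suml; apply/eqP; rewrite scaler_eq0; apply/orP; left.
    have zj1 : z ^- j - 1 != 0.
      rewrite subr_eq0 invr_eq1 -(prim_order_dvd zn) gtnNdvd //.
    rewrite -(mulrI_eq0 _ (mulfI zj1)); apply/eqP.
    under eq_bigr do rewrite mulnC exprM -exprVn.
    rewrite big_mkord -subrX1 exprVn -exprM mulnC exprM (prim_expr_order zn).
    by rewrite expr1n invr1 subrr.
  rewrite big1; last by move=> i _; apply/eqP/negPn/negP/e0.
  by move/esym/eqP; rewrite scaler_eq0 (negPf n0) (negPf x0).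
exists (e i), i; split=> //.
  have Pgj j : P (rho (g ^+ j)%g x).
    by elim: j => [|j IH]; [rewrite expg0 rep_act1|rewrite expgS rep_actM; exact: Pg].
  by apply: (@big_ind _ P) => // j _; exact: PZ.
rewrite linear_sum /= scaler_sumr.
pose f j := z ^+ i *: (z ^- (i * j) *: rho (g ^+ j)%g x).
rewrite (eq_bigr (fun j => f j.+1)); last first.
  move=> j _; rewrite linearZ /= /f -rep_actM -expgS scalerA mulnS exprD invfM.
  by rewrite mulrA divff // mul1r.
(* The shift of index exchanges [f 0] for [f n]; they agree because [g ^+ n] fixes [x] and [z ^+ n]
   is 1. *)
apply: (addIr (f 0%N)); rewrite addrC -big_nat_recl // big_nat_recr //=; congr (_ + _).
by rewrite /f gnx muln0 mulnC exprM (prim_expr_order zn) expr1n expg0 rep_act1.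
Qed.

End Eigenvectors.

Lemma int_lower_bound (x y z : int) : exists b, [/\ b <= x, b <= y & b <= z].
Proof. by exists (- (`|x| + `|y| + `|z|)%N%:Z); split; lia. Qed.

(** * Construction of the maximal subgroup and its fixed vectors *)

Section RankOneSubgroup.
Variables (F : preTopologicalFieldType) (p : nat) (v : F -> int).
Hypothesis p_prime : prime p.
Hypothesis ch : chain_valuation p v.
Hypothesis F_char_neq2 : 2%N \notin [pchar F].
Variables (W : vectType F) (form : {skew_symmetric W}) (m : int).
Hypothesis form_nondeg : nondegenerate form.
Variables (K : fieldType) (psi : F -> K).
Hypothesis p_neq0 : p%:R != 0 :> K.
Hypothesis psi_smooth : smooth_character psi.
Hypothesis psi_nontrivial : exists x, psi x != 1.
Local Notation O := (val_ideal v).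
Local Notation L := (lattice v).
Local Notation H := (heisenberg form).
Hypothesis pairing : forall a a' w w',
  L a w -> L a' w' -> O (a + a' + m) (2^-1 * form w w').
Variables (V : lmodType K) (rho : representation H K V).
Hypothesis rho_smooth : smooth rho.
Hypothesis rho_irr : irreducible rho.
Hypothesis rho_central : central_character rho psi.
Let vM := chainM ch.
Let vD := chainD ch.

Let two_neq0 : 2 != 0 :> F.
Proof. by apply: contra F_char_neq2 => /eqP two0; apply/andP; split=> //; apply/eqP. Qed.

Lemma formC w w' : form w w' = - form w' w.
Proof. by rewrite hermC /= expr1 mulN1r. Qed.

Lemma formxx w : form w w = 0.
Proof.
apply/eqP; rewrite -(mulrI_eq0 _ (mulfI two_neq0)) mulr_natl mulr2n.
by rewrite {2}formC subrr.
Qed.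

Lemma form_lattice a a' w w' : L a w -> L a' w' -> O (a + a' + m) (form w w').
Proof.
move=> wa wa'; rewrite -[form w w'](mulVKf two_neq0) mulr_natl.
by apply: ideal_mulrn => //; exact: pairing.
Qed.

Lemma heisX (w : W) (t : F) n : (((w, t) : H) ^+ n)%g = (w *+ n, t *+ n) :> H.
Proof.
elim: n => [|n IH]; first by rewrite expg0.
by rewrite expgS IH heisM /= linearMn /= formxx mul0rn mulr0 addr0 !mulrS.
Qed.

Lemma heis_conj (u g : H) : (u ^ g)%g = (u.1, u.2 + form u.1 g.1) :> H.
Proof.
apply: (mulgI g); rewrite -conjgC !heisM /=; congr pair; first by rewrite addrC.
rewrite (formC g.1 u.1) mulrN; set c := 2^-1 * _.
have -> : form u.1 g.1 = c + c by rewrite -mulr2n -mulr_natl mulVKf.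
by ring.
Qed.

Lemma heis_split (w : W) (s t : F) :
  (((w, s) : H) * heis_center form t)%g = (w, s + t) :> H.
Proof. by rewrite heisM /= linear0 mulr0 !addr0. Qed.

Lemma rep_split w s t x : rho (w, s + t) x = psi t *: rho (w, s) x.
Proof. by rewrite -heis_split rep_actM rho_central linearZ. Qed.

(** Moving [u] across [g] conjugates it, which only adds [form u.1 g.1] to its central
    coordinate. *)
Lemma fixed_translate (u g : H) x :
  rho u x = x -> rho u (rho g x) = psi (form u.1 g.1) *: rho g x.
Proof.
move=> ux; rewrite -rep_actM conjgC rep_actM heis_conj rep_split.
by case: u ux => w s /= ->; rewrite linearZ.
Qed.

Definition fixed_by (U : set H) (x : V) := forall u, U u -> rho u x = x.

Lemma fixed_by0 U : fixed_by U 0.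
Proof. by move=> u _; rewrite linear0. Qed.

Lemma fixed_byD U x y : fixed_by U x -> fixed_by U y -> fixed_by U (x + y).
Proof. by move=> Ux Uy u Uu; rewrite linearD Ux ?Uy. Qed.

Lemma fixed_byZ U a x : fixed_by U x -> fixed_by U (a *: x).
Proof. by move=> Ux u Uu; rewrite linearZ /= Ux. Qed.

(** Applied to multiples by powers of [p], this locates an element outside [U] whose p-th power is
    in [U] or over its image in [W], ready for a step of index [p]. *)
Let first_failure (Q : nat -> Prop) n : Q n -> ~ Q 0%N -> exists i, Q i.+1 /\ ~ Q i.
Proof.
elim: n => [//|n IH] Qn Q0; have [Qn'|nQn] := pselect (Q n); first exact: IH.
by exists n.
Qed.

Lemma exists_selfdual_subgroup : exists (j e : nat) (U : set H) (a b : int),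
  [/\ subgroup U, tiled (heis_lattice v (form := form) j (m + j%:Z)) U (p ^ e),
      [/\ good m a b, heis_lattice v (form := form) j (m + j%:Z) `<=` U
        & U `<=` heis_lattice v (form := form) a b],
      exists2 x, x != 0 & fixed_by U x
    & forall w, (forall u, U u -> psi (form u.1 w) = 1) -> exists t, U (w, t)].
Proof.
have [psi0 psiD _] := psi_smooth.
have gm : good m 0 m by rewrite /good !add0r.
have fm := heis_lattice_filtration ch pairing gm.
have [[x0 x0n0] _] := rho_irr.
have : nbhs (1%g : H) [set g | rho g x0 = x0].
  by apply: open_nbhs_nbhs; split; [exact: rho_smooth|exact: rep_act1].
move=> /(filt_nbhs fm)[j jP]; exists j.
pose k' := m + j%:Z; pose S := heis_lattice v (form := form) j k'.
have S0 : fixed_by S x0.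
  move=> u uS; rewrite -[u]mul1g; apply: jP.
  by rewrite add0r.
have gS : good m j k' by rewrite /good /k' addrC lerD2r lerDl.
have [mB perpB] := perp_bounded ch form_nondeg psi_smooth psi_nontrivial j.
have [N [x1 [NP x1P]]] := torsion_root p_prime ch psi_smooth psi_nontrivial W (- mB%:Z) j.
pose a1 := - mB%:Z.
(* The three bounds make [B] a subgroup, let it contain [S], and let it contain the central
   corrections, which are multiples of [x1]. *)
have [b1 [ga1 bk bx1]] := int_lower_bound (a1 + a1 + m) k' (v x1).
have aj : a1 <= j by apply: (@le_trans _ _ 0); rewrite ?oppr_le0.
pose B := heis_lattice v (form := form) a1 b1.
have sB : subgroup B := heis_lattice_subgroup ch pairing ga1.
have sS : subgroup S := heis_lattice_subgroup ch pairing gS.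
(* Only the existence of a fixed vector is recorded: enlarging [U] may replace the vector by an
   eigenvector. *)
pose P e := exists U, [/\ subgroup U, S `<=` U, U `<=` B, tiled S U (p ^ e)
  & exists2 x, x != 0 & fixed_by U x].
have P0 : exists e, `[< P e >].
  exists 0%N; apply/asboolP; exists S; split=> //.
  - exact: heis_lattice_sub.
  - by rewrite expn0; exact: tiled_refl.
  - by exists x0.
have [E EP] := heis_lattice_tiled ch pairing ga1 aj bk.
have Pbound e : `[< P e >] -> (e <= E)%N.
  move=> /asboolP[U [_ _ UB SU _]].
  by have := tiled_le sS UB SU EP; rewrite leq_exp2l // prime_gt1.
have [e /asboolP[U [sU SU UB tU [x xn0 Ux]]] emax] := ex_maxnP P0 Pbound.
have [U1 UM UV] := sU.
exists e, U, a1, b1; split=> //; first by exists x.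
(* Consequence of maximality: [g] satisfies all that is needed to extend [U] by index [p], so it
   already belongs to [U]. *)
have ext (g : H) : B g -> (forall u, U u -> U (u ^ g)%g) -> U (g ^+ p)%g ->
    (exists y, [/\ y != 0, fixed_by U y & rho g y = y]) -> U g.
  move=> Bg gU gp [y [y0 Uy gy]]; apply: contrapT => nUg.
  have /emax : `[< P e.+1 >]; last by rewrite ltnn.
  apply/asboolP; exists (cyclic_extension U g); split.
  - exact: (cyclic_extension_subgroup p_prime).
  - by move=> u /SU; exact: cyclic_extension_sub.
  - have [B1 BM _] := sB.
    move=> z [i /UB zi]; rewrite -(mulVKg (g ^+ i)%g z); apply: (BM) => //.
    by elim: i {zi} => // i IH; rewrite expgS; exact: BM.
  - by rewrite expnS; apply: tiled_trans tU _; exact: cyclic_extension_tiled.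
  - exists y => // z [i zi]; rewrite -(mulVKg (g ^+ i)%g z) rep_actM (Uy _ zi).
    exact: rep_actX.
(* The central elements of [B] killed by [psi] act trivially, so each can be adjoined; they absorb
   all later discrepancies in the central coordinate. *)
have ker t : O b1 t -> psi t = 1 -> U (heis_center form t).
  move=> tb pt; apply: contrapT => nUt.
  have [||i [iU niU]] := @first_failure (fun i => U (heis_center form (t *+ (p ^ i)))) `|(k' - b1)%R|%N.
  - apply: (SU); split=> /=; first exact: lattice0.
    rewrite /heis_center /=; have := ideal_pfactor p_prime ch `|(k' - b1)%R|%N tb.
    by apply: idealS; rewrite abszE -lerBlDl ler_norm.
  - by rewrite mulr1n.
  have tib : O b1 (t *+ (p ^ i)) by apply: ideal_mulrn.
  apply: niU; apply: ext.
  - by split=> //; exact: lattice0.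
  - by move=> u Uu; rewrite heis_conj /= linear0 addr0; case: u Uu.
  - by rewrite heisX mul0rn -mulrnA -expnSr.
  - exists x; split=> //.
    by rewrite rho_central (psiMn psi_smooth) pt expr1n scale1r.
move=> w wU; apply: contrapT => nUw.
have Sw (l : W) : L j l -> S (l, 0) by split=> //; exact: ideal0.
have wB : L a1 w.
  apply: perpB => l /Sw/SU/wU /=; rewrite formC (psiN psi_smooth) => h.
  by rewrite -[LHS]invrK h invr1.
have [||i [[s iU] niU]] := @first_failure (fun i => exists s, U (w *+ (p ^ i), s)) N.
- by exists 0; apply/SU/Sw/NP.
- by rewrite mulr1n.
pose w' := w *+ (p ^ i).
have w'B : L a1 w' by move=> l; rewrite linearMn; exact: (ideal_mulrn vM vD _ (wB l)).
have w'U u : U u -> psi (form u.1 w') = 1.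
  by move=> Uu; rewrite linearMn /= (psiMn psi_smooth) wU ?expr1n //.
(* The operator of [(w', 0)] preserves the vectors fixed by [U], as [w'] is orthogonal to [U], and
   its power [p ^ N] fixes them because [w' *+ p ^ N] is in the small lattice. *)
have [|||y [i' [y0 Uy yE]]] := @rep_eigenvector _ _ _ rho (fixed_by U) ((w', 0) : H) _ _ x x1P _
    (@fixed_by0 U) (@fixed_byD U) (@fixed_byZ U) _ Ux xn0.
- by rewrite natrX expf_neq0.
- by move=> y Uy u Uu; rewrite fixed_translate ?w'U ?scale1r //; exact: Uy.
- by apply/Ux; rewrite heisX mul0rn; apply/SU/Sw/NP.
pose t := - (x1 *+ i').
have tb : O b1 t.
  apply: idealN => //; apply: ideal_mulrn => //; by right.
have gy : rho (w', t) y = y.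
  by rewrite -[t]add0r rep_split yE scalerA psiN // psiMn // mulVf ?scale1r // expf_neq0 // psi_neq0.
(* Conjugation by [(w', t)] moves [u] by a central element of coordinate [form u.1 w'], where [psi]
   is 1; hence [ker] shows that [U] is normalised. *)
apply: niU; exists t; apply: ext => //; last by exists y.
  move=> u Uu; rewrite heis_conj /=; case: u Uu => w2 s2 Uu; rewrite -heis_split.
  apply: UM => //; apply: ker; last exact: (w'U _ Uu).
  have [w2B _] := UB _ Uu.
  by apply: idealS (form_lattice w2B w'B).
(* Both this power and the element of [U] over [w *+ p ^ i.+1] fix [y], so [psi] is 1 on their
   central difference and [ker] applies again. *)
have gp : (((w', t) : H) ^+ p)%g = (w *+ (p ^ i.+1), s + (t *+ p - s)) :> H.
  by rewrite heisX /w' -mulrnA -expnSr addrC subrK.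
rewrite gp -heis_split; apply: UM => //; apply: ker.
  have [_ sb] := UB _ iU.
  by apply: idealB => //; exact: ideal_mulrn.
have := rep_actX p gy; rewrite gp rep_split (Uy _ iU) => /eqP.
by rewrite -subr_eq0 -[X in _ - X]scale1r -scalerBl scaler_eq0 (negPf y0) orbF subr_eq0 => /eqP.
Qed.


Section FixedLine.
Variables (U : set H) (x0 : V).
Hypothesis x0_fixed : fixed_by U x0.
Hypothesis x0_neq0 : x0 != 0.
Hypothesis U_selfdual :
  forall w, (forall u, U u -> psi (form u.1 w) = 1) -> exists t, U (w, t).

Let nontrivial_eigen (y : V) := exists w,
  (forall u, U u -> rho u y = psi (form u.1 w) *: y) /\
  exists u, U u /\ psi (form u.1 w) != 1.

Let nontrivial_eigenZ a y : nontrivial_eigen y -> nontrivial_eigen (a *: y).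
Proof.
move=> [w [yw wn]]; exists w; split=> // u Uu.
by rewrite linearZ /= yw // !scalerA mulrC.
Qed.

(* Applying rho u - chi(u), where chi is the eigencharacter of the first term,
   removes that term and multiplies the fixed vector by 1 - chi(u). *)
Let nontrivial_eigen_sum (s : seq V) : (forall y, y \in s -> nontrivial_eigen y) ->
  fixed_by U (\sum_(y <- s) y) -> \sum_(y <- s) y = 0.
Proof.
move: {2}(size s) (leqnn (size s)) => n; elim: n s => [|n IH] [|y s] //=; rewrite ?big_nil //.
rewrite ltnS => sn sQ; have [w [yw [u [Uu un]]]] := sQ y (mem_head _ _).
set x := \sum_(_ <- _) _ => Ux; pose c := psi (form u.1 w).
pose s' := [seq rho u z - c *: z | z <- s].
have s'E : \sum_(z <- s') z = (1 - c) *: x.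
  rewrite big_map sumrB -linear_sum -scaler_sumr.
  have -> : \sum_(z <- s) z = x - y by rewrite /x big_cons addrAC subrr add0r.
  by rewrite linearB /= Ux // yw // -/c scalerBr opprB addrA subrK scalerBl scale1r.
have : \sum_(z <- s') z = 0.
  apply: IH; first by rewrite size_map.
    move=> _ /mapP[z zs ->]; have zQ : nontrivial_eigen z by apply: sQ; rewrite inE zs orbT.
    by have [w' [zw' _]] := zQ; rewrite zw' // -scalerBl; exact: nontrivial_eigenZ.
  by rewrite s'E; exact: fixed_byZ.
by move=> /eqP; rewrite s'E scaler_eq0 subr_eq0 eq_sym (negPf un) => /eqP.
Qed.

Let span (x : V) := exists s : seq (K * H), x = \sum_(a <- s) a.1 *: rho a.2 x0.

Let span_all x : span x.
Proof.
have [_ /(_ [pred x | `[< span x >]])] := rho_irr; case.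
- split; first by apply/asboolP; exists [::]; rewrite big_nil.
  move=> a y z /asboolP[s ->] /asboolP[s' ->]; apply/asboolP.
  exists ([seq (a * b.1, b.2) | b <- s] ++ s').
  rewrite big_cat big_map /= scaler_sumr; congr (_ + _).
  by apply: eq_bigr => b _; rewrite scalerA.
- move=> g y /asboolP[s ->]; apply/asboolP.
  exists [seq (b.1, g * b.2)%g | b <- s].
  rewrite big_map linear_sum; apply: eq_bigr => b _ /=.
  by rewrite linearZ /= rep_actM.
- move=> all0; case/eqP: x0_neq0; apply: all0; apply/asboolP.
  by exists [:: (1, 1%g)]; rewrite big_seq1 scale1r rep_act1.
- by move=> /(_ x)/asboolP.
Qed.

(** In an expression of [x] by translates of [x0], those not on the line add up to a fixed vector,
    which vanishes by independence of nontrivial characters. *)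
Lemma fixed_line x : fixed_by U x -> exists c, x = c *: x0.
Proof.
suff [c [s [sQ xE]]] : exists c s, (forall y, y \in s -> nontrivial_eigen y) /\
    x = c *: x0 + \sum_(y <- s) y.
  move=> Ux; exists c; rewrite xE nontrivial_eigen_sum ?addr0 //.
  rewrite (_ : \sum_(y <- s) y = x + (- c) *: x0).
    by apply: fixed_byD => //; exact: fixed_byZ.
  by rewrite xE scaleNr addrAC subrr add0r.
have [s ->] := span_all x; elim: s => [|[a h] s [c [s' [s'Q IH]]]].
  by exists 0, [::]; split=> //; rewrite !big_nil scale0r addr0.
rewrite big_cons IH /=.
have [hU|hU] := pselect (forall u, U u -> psi (form u.1 h.1) = 1).
  (* The translating element [h] differs from [(h.1, t)], which fixes [x0], by a central element
     acting as [psi (h.2 - t)]. *)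
  have [t Ut] := U_selfdual hU; exists (a * psi (h.2 - t) + c), s'; split=> //.
  have -> : rho h x0 = psi (h.2 - t) *: x0.
    rewrite -{2}(x0_fixed Ut) -rep_split addrC subrK.
    by case: (h).
  by rewrite scalerA addrA scalerDl.
exists c, (a *: rho h x0 :: s'); split; last by rewrite big_cons addrCA.
move=> y; rewrite inE => /predU1P[->|]; last exact: s'Q.
apply: nontrivial_eigenZ; exists h.1; split.
  by move=> u Uu; rewrite fixed_translate // x0_fixed.
apply: contrapT => nu; apply: hU => u Uu; apply/eqP/negPn/negP => un.
by apply: nu; exists u.
Qed.

End FixedLine.

End RankOneSubgroup.

(** * Hecke operators and their traces *)

(** Injectivity makes the two supports equal; if they are infinite, both sums take the default value
    0. *)
Lemma fsbig_linear (R : nzRingType) (V V' : lmodType R) (h : {linear V -> V'})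
    (T : choiceType) (f : T -> V) : injective h ->
  h (\sum_(i \in [set: T]) f i) = \sum_(i \in [set: T]) h (f i).
Proof.
move=> h_inj.
have suppE : [set: T] `&` (h \o f) @^-1` [set~ 0] = [set: T] `&` f @^-1` [set~ 0].
  apply/seteqP; split=> i [_ /= fi]; split=> // f0; apply: fi; first by rewrite f0 linear0.
  by apply: h_inj; rewrite f0 linear0.
have [fin|inf] := pselect (finite_set ([set: T] `&` f @^-1` [set~ 0])); last first.
  by rewrite !fsbig_dflt ?linear0 // -[X in infinite_set X]/([set: T] `&` (h \o f) @^-1` [set~ 0]) suppE.
rewrite fsbig_supp [RHS]fsbig_supp -[X in _ = \big[_/_]_(i \in X) _]/([set: T] `&` (h \o f) @^-1` [set~ 0]) suppE.
by rewrite !fsbig_finite //= linear_sum.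
Qed.

Section Trace.
Variables (F : preTopologicalFieldType) (p : nat) (v : F -> int).
Hypothesis ch : chain_valuation p v.
Variables (W : vectType F) (form : {skew_symmetric W}) (m : int).
Local Notation H := (heisenberg form).
Local Notation O := (val_ideal v).
Local Notation L := (lattice v).
Local Notation Gam := (heis_lattice v (form := form)).
Hypothesis pairing : forall a a' w w',
  L a w -> L a' w' -> O (a + a' + m) (2^-1 * form w w').
Variables (K : fieldType) (psi : F -> K).
Hypothesis psi_smooth : smooth_character psi.
Variables (V : lmodType K) (rho : representation H K V).
Hypothesis rho_smooth : smooth rho.
Hypothesis rho_central : central_character rho psi.
Variables (R0 : fieldType) (iota0 : {rmorphism R0 -> K}) (mu : set H -> R0).
Hypothesis mu_haar : haar_measure mu.
Variables (U : set H) (x0 : V) (a b : int) (j : nat).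
Hypotheses (sU : subgroup U) (gab : good m a b) (UGam : U `<=` Gam a b).
Hypothesis GamU : Gam j (m + j%:Z) `<=` U.
Hypotheses (x0_neq0 : x0 != 0) (x0_fixed : fixed_by rho U x0).
Hypothesis x0_line : forall x, fixed_by rho U x -> exists c, x = c *: x0.

Let vM := chainM ch.
Let vD := chainD ch.

Let fm : filtration (fun i : nat => Gam (0 + i%:Z) (m + i%:Z)).
Proof. by apply: (heis_lattice_filtration ch pairing); rewrite /good !add0r. Qed.

Let GamU' : Gam (0 + j%:Z) (m + j%:Z) `<=` U.
Proof. by rewrite add0r. Qed.

Let zU t := [set x : H | U (heis_center form (- t) * x)%g].

Let centerM s t : (heis_center form s * heis_center form t)%g = heis_center form (s + t).
Proof. by rewrite heisM /heis_center /= linear0 mulr0 !addr0. Qed.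

Let centerC t x : (heis_center form t * x)%g = (x * heis_center form t)%g.
Proof. by rewrite !heisM /= linear0l linear0r mulr0 addrC [t + _]addrC. Qed.

Let centerK t x : (heis_center form t * (heis_center form (- t) * x))%g = x.
Proof. by rewrite mulgA centerM subrr mul1g. Qed.

Let centerVK t x : (heis_center form (- t) * (heis_center form t * x))%g = x.
Proof. by rewrite mulgA centerM addNr mul1g. Qed.

Let zU_compact t (A : set H) i : A `<=` zU t ->
  (forall x u, A x -> Gam (0 + i%:Z) (m + i%:Z) u -> A (x * u)%g) -> Defs.compact_open A.
Proof.
move=> At Ainv; split; last exact: (invariant_open fm Ainv).
(* Lowering the central level to [v t] gives a compact lattice that also contains the translate of
   [U] by the central element. *)
have gt : good m a (Num.min b (v t)) by apply: le_trans gab; rewrite ge_min lexx.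
apply: (subclosed_compact (invariant_closed fm Ainv) (heis_lattice_compact ch pairing gt)).
move=> x /At/UGam [xa xb]; split.
  by move: xa; rewrite /= add0r.
have -> : x.2 = t + (heis_center form (- t) * x)%g.2.
  by rewrite heisM /= linear0l mulr0 addr0 addrA subrr add0r.
apply: idealD => //.
  by right; rewrite ge_min lexx orbT.
by apply: idealS xb; rewrite ge_min lexx.
Qed.

Let zU_mulr t x u : zU t x -> U u -> zU t (x * u)%g.
Proof. by have [_ UM _] := sU => tx Uu; rewrite /zU /= mulgA; exact: UM. Qed.

Let zU_mull t x u : U u -> zU t x -> zU t (u * x)%g.
Proof.
by have [_ UM _] := sU => Uu tx; rewrite /zU /= mulgA centerC -mulgA; exact: UM.
Qed.

Let U_compact_open : Defs.compact_open U.
Proof.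
apply: (@zU_compact 0 _ j) => [x Ux|x u Ux /GamU' Uu].
  by rewrite /zU /= oppr0 mul1g.
by have [_ UM _] := sU; exact: UM.
Qed.

Let mu0 : mu set0 = 0. Proof. exact: haar_set0 mu_haar. Qed.

Let mu_zU t : mu (zU t) = mu U.
Proof.
have [_ muM _] := mu_haar.
rewrite -(muM (heis_center form t) U U_compact_open); congr mu.
apply/seteqP; split=> [x tx|_ [x Ux <-]]; last by rewrite /zU /= centerVK.
by exists (heis_center form (- t) * x)%g.
Qed.

Definition coset_indicator t (g : H) : R0 := (`[< zU t g >])%:R.

Let indicatorE t g : coset_indicator t g = (`[< zU t g >])%:R.
Proof. by []. Qed.

Lemma coset_indicator_hecke t : hecke_function (coset_indicator t).
Proof.
split=> [c|].
  apply: (invariant_open fm (j := j)) => x u /= xc /GamU' Uu; rewrite -xc.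
  rewrite /coset_indicator; congr (_%:R); congr nat_of_bool; apply/asbool_equiv_eq; split => [xu|].
    by rewrite -(mulgK u x); apply: zU_mulr => //; have [_ _] := sU; exact.
  by move=> tx; exact: zU_mulr.
suff [] : Defs.compact_open [set g | coset_indicator t g != 0] by [].
have E : [set g | coset_indicator t g != 0] = zU t.
  apply/seteqP; split=> g; rewrite /= indicatorE.
    by case: asboolP => //; rewrite eqxx.
  by move=> tg; rewrite asboolT // oner_neq0.
by rewrite E; apply: (@zU_compact t _ j) => // x u tx /GamU'; exact: zU_mulr.
Qed.

(** The level of 0 contains the complement of [zU t] and need not be compact, but it is weighted by
    the vector 0; hence the condition on [w] below. *)
Let level t (x w : V) := [set g | iota0 (coset_indicator t g) *: rho g x = w].

Let levelE t x w : w != 0 -> level t x w = [set g | zU t g /\ rho g x = w].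
Proof.
move=> w0; apply/seteqP; split=> g; rewrite /level /= indicatorE.
  case: asboolP => tg; first by rewrite rmorph1 scale1r.
  by rewrite rmorph0 scale0r => w0'; rewrite -w0' eqxx in w0.
by move=> [tg gw]; rewrite asboolT // rmorph1 scale1r.
Qed.

Let level_compact_open t x w : w != 0 -> Defs.compact_open (level t x w).
Proof.
move=> w0; rewrite levelE //.
have : nbhs (1%g : H) [set g | rho g x = x].
  by apply: open_nbhs_nbhs; split; [exact: rho_smooth|exact: rep_act1].
move=> /(filt_nbhs fm)[i iP]; apply: (@zU_compact t _ (maxn i j)) => [g []//|].
move=> g u [tg gw] ui; split.
  apply: zU_mulr => //; apply: GamU'; apply: heis_lattice_sub ui; lia.
rewrite rep_actM -[RHS]gw; congr (rho g _).
by rewrite -[u]mul1g; apply: iP; apply: heis_lattice_sub ui; lia.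
Qed.

(** Substituting [rho u w] for [w] permutes the sum, and the corresponding levels are translates by
    [u], because [zU t] is stable under [U] on the left; the invariance of [mu] concludes. *)
Lemma hecke_act_fixed t x : fixed_by rho U (hecke_act iota0 rho mu (coset_indicator t) x).
Proof.
move=> u Uu; have [_ _ UV] := sU.
have uK : cancel (rho u) (rho u^-1%g) by move=> y; rewrite -rep_actM mulVg rep_act1.
have uKV : cancel (rho u^-1%g) (rho u) by move=> y; rewrite -rep_actM mulgV rep_act1.
rewrite /hecke_act fsbig_linear; last exact: can_inj uK.
rewrite [RHS](reindex_fsbigT (rho u)) /=; last by exists (rho u^-1%g).
apply: eq_fsbigr => w _; rewrite linearZ /=.
have [->|w0] := eqVneq w 0; first by rewrite linear0 !scaler0.
have uw0 : rho u w != 0.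
  by apply: contra_neq w0 => uw; rewrite -[w]uK uw linear0.
congr (iota0 _ *: _); have [_ muM _] := mu_haar.
rewrite -(muM u _ (level_compact_open t x w0)); congr mu.
rewrite -/(level t x (rho u w)) !levelE //; apply/seteqP; split.
  move=> _ [g [tg gw] <-]; split; first exact: zU_mull.
  by rewrite rep_actM gw.
move=> g [tg gw]; exists (u^-1 * g)%g; last by rewrite mulVKg.
by split; [apply: zU_mull => //; exact: UV|rewrite rep_actM gw uK].
Qed.

(** The integrand is constant on [zU t], so a single level contributes. *)
Lemma hecke_act_line t :
  hecke_act iota0 rho mu (coset_indicator t) x0 = (iota0 (mu U) * psi t) *: x0.
Proof.
have act g : zU t g -> rho g x0 = psi t *: x0.
  by move=> tg; rewrite -(centerK t g) rep_actM rho_central x0_fixed.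
have w1 : psi t *: x0 != 0 by rewrite scaler_eq0 negb_or psi_neq0.
rewrite /hecke_act -(@fsbig_widen _ _ _ _ [set psi t *: x0]) //.
  rewrite fsbig_set1 -/(level t x0 _) levelE // scalerA; congr (iota0 _ * _ *: _).
  rewrite -(mu_zU t); congr mu; apply/seteqP; split=> [g []//|g tg].
  by split=> //; exact: act.
move=> w [_ /= ww1]; have [->|w0] := eqVneq w 0; first by rewrite scaler0.
rewrite -/(level t x0 w) levelE // (_ : [set _ | _] = set0) ?mu0 ?rmorph0 ?scale0r //.
by apply/seteqP; split=> // g [tg gw]; apply: ww1; rewrite -gw act.
Qed.

Lemma hecke_trace_line t : hecke_traces iota0 rho (iota0 (mu U) * psi t).
Proof.
exists mu, (coset_indicator t); split=> //; first exact: coset_indicator_hecke.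
exists 1%N, (fun=> x0), (iota0 (mu U) * psi t)%:M; split.
- move=> c; rewrite big_ord1 => /eqP; rewrite scaler_eq0 (negPf x0_neq0) orbF => /eqP c0 i.
  by rewrite ord1.
- move=> x; have [c cP] := x0_line (hecke_act_fixed t x).
  by exists (fun=> c); rewrite big_ord1.
- by move=> i; rewrite big_ord1 ord1 mxE eqxx mulr1n hecke_act_line.
- by rewrite mxtrace_scalar mulr1n.
Qed.

End Trace.

(** * Extension of scalars *)

(* The tensor product of L and V is realised as the quotient of the formal sums
   of elements of L * V by the relation of having equal images under all
   semilinear maps; impredicativity of Prop makes its universal property
   immediate. *)
Section ScalarExtension.
Variables (R L : fieldType) (j : {rmorphism R -> L}) (V : lmodType R).
Local Notation semilinear M := {linear V -> M | j \; *:%R}.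

Definition formal_eval (M : lmodType L) (f : semilinear M) (s : seq (L * V)) : M :=
  \sum_(a <- s) a.1 *: f a.2.

Definition formal_eq (s s' : seq (L * V)) : bool :=
  `[< forall (M : lmodType L) (f : semilinear M), formal_eval f s = formal_eval f s' >].

Fact formal_eq_refl : reflexive formal_eq.
Proof. by move=> s; apply/asboolP. Qed.

Fact formal_eq_sym : symmetric formal_eq.
Proof. by move=> s s'; apply/asboolP/asboolP => ss' M f; rewrite ss'. Qed.

Fact formal_eq_trans : transitive formal_eq.
Proof. by move=> s s' s'' /asboolP ss' /asboolP ss''; apply/asboolP => M f; rewrite ss'. Qed.

Canonical formal_eq_equiv := EquivRel formal_eq formal_eq_refl formal_eq_sym formal_eq_trans.

Definition extension := {eq_quot formal_eq}%qT.
HB.instance Definition _ : EqQuotient _ formal_eq extension := EqQuotient.on extension.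
HB.instance Definition _ := Choice.on extension.

Definition extension_eval (M : lmodType L) (f : semilinear M) (x : extension) : M :=
  formal_eval f (repr x).

Definition formal_class (s : seq (L * V)) : extension := \pi_extension%qT s.

Lemma extension_evalE (M : lmodType L) (f : semilinear M) s :
  extension_eval f (formal_class s) = formal_eval f s.
Proof.
rewrite /extension_eval /formal_class.
have /eqmodP/asboolP : (\pi_extension (repr (\pi_extension s)) = \pi_extension s)%qT.
  by rewrite reprK.
exact.
Qed.

Lemma extension_ext (x y : extension) :
  (forall (M : lmodType L) (f : semilinear M), extension_eval f x = extension_eval f y) ->
  x = y.
Proof.
move=> xy; rewrite -[x]reprK -[y]reprK.
by apply/eqmodP/asboolP.
Qed.

Definition extension_add (x y : extension) := formal_class (repr x ++ repr y).
Definition extension_opp (x : extension) := formal_class [seq (- a.1, a.2) | a <- repr x].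
Definition extension_scale c (x : extension) :=
  formal_class [seq (c * a.1, a.2) | a <- repr x].

Lemma extension_eval0 (M : lmodType L) (f : semilinear M) :
  extension_eval f (formal_class [::]) = 0.
Proof. by rewrite extension_evalE /formal_eval big_nil. Qed.

Lemma extension_evalD (M : lmodType L) (f : semilinear M) x y :
  extension_eval f (extension_add x y) = extension_eval f x + extension_eval f y.
Proof. by rewrite extension_evalE /formal_eval big_cat. Qed.

Lemma extension_evalN (M : lmodType L) (f : semilinear M) x :
  extension_eval f (extension_opp x) = - extension_eval f x.
Proof.
rewrite extension_evalE /extension_eval /formal_eval big_map -sumrN.
by apply: eq_bigr => a _; rewrite scaleNr.
Qed.

Lemma extension_evalZ (M : lmodType L) (f : semilinear M) c x :
  extension_eval f (extension_scale c x) = c *: extension_eval f x.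
Proof.
rewrite extension_evalE /extension_eval /formal_eval big_map scaler_sumr.
by apply: eq_bigr => a _; rewrite scalerA.
Qed.

Let evE := (extension_eval0, extension_evalD, extension_evalN, extension_evalZ).

Fact extension_addA : associative extension_add.
Proof. by move=> x y z; apply: extension_ext => M f; rewrite !evE addrA. Qed.
Fact extension_addC : commutative extension_add.
Proof. by move=> x y; apply: extension_ext => M f; rewrite !evE addrC. Qed.
Fact extension_add0 : left_id (formal_class [::]) extension_add.
Proof. by move=> x; apply: extension_ext => M f; rewrite !evE add0r. Qed.
Fact extension_addN : left_inverse (formal_class [::]) extension_opp extension_add.
Proof. by move=> x; apply: extension_ext => M f; rewrite !evE addNr. Qed.

HB.instance Definition _ := GRing.isZmodule.Build extension
  extension_addA extension_addC extension_add0 extension_addN.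

Fact extension_scaleA c c' x :
  extension_scale c (extension_scale c' x) = extension_scale (c * c') x.
Proof. by apply: extension_ext => M f; rewrite !evE scalerA. Qed.
Fact extension_scale1 : left_id 1 extension_scale.
Proof. by move=> x; apply: extension_ext => M f; rewrite !evE scale1r. Qed.
Fact extension_scaleDr : right_distributive extension_scale +%R.
Proof. by move=> c x y; apply: extension_ext => M f; rewrite !evE scalerDr. Qed.
Fact extension_scaleDl x : {morph extension_scale^~ x : c c' / c + c'}.
Proof. by move=> c c'; apply: extension_ext => M f; rewrite !evE scalerDl. Qed.

HB.instance Definition _ := GRing.Zmodule_isLmodule.Build L extension
  extension_scaleA extension_scale1 extension_scaleDr extension_scaleDl.

Fact extension_eval_linear (M : lmodType L) (f : semilinear M) : linear (extension_eval f).
Proof. by move=> c x y; rewrite -extension_evalZ -extension_evalD. Qed.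

HB.instance Definition _ (M : lmodType L) (f : semilinear M) :=
  GRing.isLinear.Build L extension M *:%R (extension_eval f) (extension_eval_linear f).

Definition extension_embed (x : V) : extension := formal_class [:: (1, x)].

Lemma extension_eval_embed (M : lmodType L) (f : semilinear M) x :
  extension_eval f (extension_embed x) = f x.
Proof. by rewrite extension_evalE /formal_eval big_seq1 scale1r. Qed.

Fact extension_embed_linear : linear_for (j \; *:%R) extension_embed.
Proof.
move=> c x y; apply: extension_ext => M f; rewrite linearP /=.
by rewrite !extension_eval_embed linearP.
Qed.

HB.instance Definition _ :=
  GRing.isLinear.Build R V extension (j \; *:%R) extension_embed extension_embed_linear.

Lemma extensionE (x : extension) :
  x = \sum_(a <- repr x) a.1 *: extension_embed a.2.
Proof.
apply: extension_ext => M f; rewrite linear_sum /=.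
by apply: eq_bigr => a _; rewrite linearZ /= extension_eval_embed.
Qed.

Lemma extension_universal : is_scalar_extension (extension_embed : semilinear extension).
Proof.
move=> M f; exists (extension_eval f); split=> [x|g gP x].
  exact: extension_eval_embed.
rewrite (extensionE x) !linear_sum; apply: eq_bigr => a _.
by rewrite !linearZ /= gP extension_eval_embed.
Qed.

Section Representation.
Variables (G : groupType) (rho : representation G R V).

(** The action on the extension is the linear map associated with this semilinear one by the
    universal property. *)
Definition embed_act g (x : V) : extension := extension_embed (rho g x).

Fact embed_act_linear g : linear_for (j \; *:%R) (embed_act g).
Proof. by move=> c x y; rewrite /embed_act !linearP. Qed.

HB.instance Definition _ g :=
  GRing.isLinear.Build R V extension (j \; *:%R) (embed_act g) (embed_act_linear g).

Definition extension_act g : {linear extension -> extension} := extension_eval (embed_act g).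

Lemma extension_act_embed g x : extension_act g (extension_embed x) = extension_embed (rho g x).
Proof. exact: extension_eval_embed. Qed.

Fact extension_act1 x : extension_act 1%g x = x.
Proof.
rewrite (extensionE x) linear_sum; apply: eq_bigr => a _.
by rewrite linearZ extension_act_embed rep_act1.
Qed.

Fact extension_actM g h x : extension_act (g * h)%g x = extension_act g (extension_act h x).
Proof.
rewrite (extensionE x) linear_sum [extension_act h _]linear_sum.
rewrite [RHS]linear_sum; apply: eq_bigr => a _.
by rewrite !linearZ !extension_act_embed rep_actM.
Qed.

Lemma rep_extension_exists : exists (VL : lmodType L) (rhoL : representation G L VL),
  is_rep_extension j rho rhoL.
Proof.
exists extension, (Representation extension_act1 extension_actM).
exists extension_embed; split; first exact: extension_universal.
exact: extension_act_embed.
Qed.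

End Representation.

End ScalarExtension.

(** * The rationality field and the Schur index *)

Lemma prime_field_natr (p : nat) (c : option nat) : prime p ->
  allowed_characteristic p c -> p%:R != 0 :> prime_field c.
Proof.
move=> p_pr; case: c => [l [l_pr lp]|_] /=; last by rewrite pnatr_eq0 -lt0n prime_gt0.
rewrite -(dvdn_pcharf (pchar_Fp l_pr)) dvdn_prime2 //.
by apply/eqP.
Qed.

Lemma chain_valuation_exists (F : preTopologicalFieldType) (p f : nat) :
  finite_or_local_field F (p ^ f) -> exists v : F -> int, chain_valuation p v.
Proof.
move=> [/finite_chain_valuation|/local_chain_valuation//].
by exists (fun=> 0).
Qed.

(** A characteristic [l] prime to [p] would give a Bezout relation making 1 a multiple of [p] in
    [F], hence an element of the ideal of level 1. *)
Lemma chain_valuation_char (F : preTopologicalFieldType) (p : nat) (v : F -> int) l :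
  prime p -> chain_valuation p v -> l \in [pchar F] -> p%:R = 0 :> F.
Proof.
move=> p_pr ch /andP[l_pr l0]; apply: contrapT => /eqP p0.
have cpl : coprime p l.
  rewrite prime_coprime // dvdn_prime2 //; apply: contraNneq p0 => ->.
  exact: l0.
have /(coprimeP _ (prime_gt0 p_pr))[[a b] /= ab] := cpl.
have vM := chainM ch; have vD := chainD ch.
apply: (ideal1n vM); have -> : 1 = a%:R * p%:R :> F.
  by rewrite -[LHS](congr1 (fun n => n%:R) ab) natrB ?natrM ?(eqP l0) ?mulr0 ?subr0 //; lia.
by rewrite -[1]add0r; apply: (idealM vM (ideal_natr vM vD a) (chain_char ch)).
Qed.

(** Only differences and quotients are available from [divring_closed]; sums and products are
    recovered from them, and polynomials are evaluated by Horner's scheme. *)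
Lemma divring_generated (R0 K : fieldType) (iota0 : {rmorphism R0 -> K})
    (L : {pred K}) (z : K) : GRing.divring_closed L ->
  (forall a, iota0 a \in L) -> z \in L -> generated_by iota0 z `<=` [set` L].
Proof.
move=> [L1 LB LV] L0 Lz _ [P _ <-] /=.
have LD x y : x \in L -> y \in L -> x + y \in L.
  by move=> Lx Ly; rewrite -[y]opprK LB // -sub0r LB // -(rmorph0 iota0).
have LM x y : x \in L -> y \in L -> x * y \in L.
  by move=> Lx Ly; rewrite -[y]invrK LV // -div1r LV.
elim/poly_ind: P => [|P c IH]; first by rewrite rmorph0 horner0 -(rmorph0 iota0).
rewrite rmorphD rmorphM /= map_polyX map_polyC !hornerE.
by apply: LD; [exact: LM|exact: L0].
Qed.

Lemma extension_degree_neq0 (Rbar R' : fieldType) (j : {rmorphism R' -> Rbar}) k d :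
  extension_degree k (range j) d -> (0 < d)%N.
Proof.
case: d => // -[_ [e [_ _ /(_ 1)]]].
case; first by exists 1; rewrite ?rmorph1.
by move=> c _; rewrite big_ord0 => /eqP; rewrite oner_eq0.
Qed.

(** The embedded field of coefficients realises [rho] and has degree 1 over itself; the lower bound
    only has to exclude degree 0. *)
Lemma schur_index1 (G : preTopologicalGroupType) (R0 R : fieldType)
    (iota0 : {rmorphism R0 -> R}) (V : lmodType R) (rho : representation G R V)
    (Rbar : closedFieldType) (iota : {rmorphism R -> Rbar}) :
  smooth rho -> rationality_field iota0 rho = [set: R] ->
  is_schur_index iota0 rho iota 1.
Proof.
move=> rho_smooth ratE; split; last first.
  by move=> d [L [R' [j [<- _]]] /extension_degree_neq0].
exists (range iota); rewrite ?ratE.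
  exists R, iota; split=> //; exists V, rho; split=> //.
  by have [VL [rhoL ext]] := rep_extension_exists iota rho; exists VL, rhoL.
split=> //; exists (fun=> 1); split.
- by move=> _; exists 1; rewrite ?rmorph1.
- by move=> c _; rewrite big_ord1 mulr1 => c0 i; rewrite ord1.
- by move=> x rx; exists (fun=> x) => //; rewrite big_ord1 mulr1.
Qed.

Theorem proposition6p1
  (p f : nat) (p_prime : prime p)
  (F : preTopologicalFieldType) (F_char_neq2 : 2%N \notin [pchar F])
  (F_finite_or_local : finite_or_local_field F (p ^ f))
  (c : option nat) (c_allowed : allowed_characteristic p c)
  (K : fieldType) (iota0 : {rmorphism prime_field c -> K})
  (K_cyclotomic : cyclotomic_coefficients F p iota0)
  (psi : F -> K) (psi_smooth : smooth_character psi)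
  (psi_nontrivial : exists x, psi x != 1)
  (W : vectType F) (form : {skew_symmetric W})
  (form_symplectic : is_psymplectic form)
  (V : lmodType K) (rho : representation (heisenberg form) K V)
  (rho_smooth : smooth rho) (rho_irreducible : irreducible rho)
  (rho_central : central_character rho psi) :
  rationality_field iota0 rho = [set: K] /\
  forall (Kbar : closedFieldType) (iota : {rmorphism K -> Kbar}),
    is_algebraic_closure iota -> is_schur_index iota0 rho iota 1%N.
Proof.
suff ratE : rationality_field iota0 rho = [set: K].
  by split=> // Kbar iota _; exact: schur_index1.
have [v ch] := chain_valuation_exists F_finite_or_local.
have [form_nondeg _ _] := form_symplectic.
have [m pairing] := pairing_bound ch form.
have p0 := prime_field_natr p_prime c_allowed.
have pK : p%:R != 0 :> K by rewrite -(rmorph_nat iota0) fmorph_eq0.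
have gm i : good m (0 + i%:Z) (m + i%:Z) by rewrite /good; lia.
have [j [e [U [a [b [sU tU [gab SU UB] [x0 x0_neq0 Ux0] Uperp]]]]]] :=
  exists_selfdual_subgroup p_prime ch F_char_neq2 form_nondeg pK psi_smooth
    psi_nontrivial pairing rho_smooth rho_irreducible rho_central.
have gm0 : good m 0 m by rewrite /good !add0r.
have fm := heis_lattice_filtration ch pairing gm0.
have /choice[k tk] : forall i : nat, exists e,
    tiled (heis_lattice v (form := form) (0 + i.+1%:Z) (m + i.+1%:Z))
      (heis_lattice v (0 + i%:Z) (m + i%:Z)) (p ^ e).
  by move=> i; apply: (heis_lattice_tiled ch pairing (gm i)); lia.
have pk i : (p ^ i)%:R != 0 :> prime_field c by rewrite natrX expf_neq0.
have muH := haar_is_measure fm tk (fun i => pk (k i))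
  (heis_lattice_compact ch pairing (gm 0%N)).
set mu := haar _ _ _ in muH.
have muU : iota0 (mu U) != 0.
  rewrite fmorph_eq0; apply: (haar_tiled fm tk (fun i => pk (k i)) (j := j)) (pk e).
  by rewrite add0r.
have x0_line := fixed_line F_char_neq2 rho_irreducible rho_central Ux0 x0_neq0 Uperp.
have tr t := hecke_trace_line ch pairing psi_smooth rho_smooth rho_central iota0 muH sU gab UB SU
  x0_neq0 Ux0 x0_line t.
apply/seteqP; split=> // x _ L Ldiv L0 Ltr.
have [L1 LB LV] := Ldiv.
(* [psi t] is the quotient of the traces attached to [t] and to 0, which removes the volume of
   [U]. *)
have Lpsi t : psi t \in L.
  have [psi0 _ _] := psi_smooth.
  rewrite -[psi t](mulKf muU) mulrC; apply: LV; first exact: Ltr.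
  by rewrite -[X in X \in L]mulr1 -psi0; exact: Ltr.
have LX n y : y \in L -> y ^+ n \in L.
  move=> Ly; elim: n => // n IH.
  by rewrite exprSr -[y in _ * y]invrK; apply: (LV) => //; rewrite -div1r; exact: LV.
have Lroot n n' (y z : K) : (n %| n')%N -> y \in L -> n'.-primitive_root y ->
    n.-primitive_root z -> z \in L.
  move=> nn' Ly yn zn; have [|i ->] := prim_rootP yn (x := z); last exact: LX.
  by apply/eqP; rewrite -(prim_order_dvd zn).
have [Kchar Kchar0] := K_cyclotomic.
(* In positive characteristic one value of [psi] of order [p] suffices; in characteristic 0 each [x]
   requires a value whose order is a sufficiently large power of [p]. *)
have [charF|charF] := pselect (exists l, l \in [pchar F]).
  have [l lF] := charF; have pF := chain_valuation_char p_prime ch lF.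
  have [z zp Kz] := Kchar charF.
  have [t tp] := psi_primitive_char p_prime psi_smooth psi_nontrivial pF.
  apply: (divring_generated Ldiv L0 (z := z)); last by rewrite Kz.
  exact: Lroot tp zp.
have pF : p%:R != 0 :> F.
  by apply/eqP => pF; apply: charF; exists p; apply/andP; split=> //; apply/eqP.
have [|_ /(_ x)[n [z zn Kz]]] := Kchar0.
  by move=> l; apply/negbTE/negP => lF; apply: charF; exists l.
have [n' [t [nn' tn]]] := psi_primitive p_prime ch psi_smooth psi_nontrivial pF n.
apply: (divring_generated Ldiv L0 (z := z)) => //.
by apply: Lroot tn zn => //; exact: dvdn_exp2l.
Qed.
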